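(* Under the assumptions in the context, the dual of the linear program $$\text{(P)}\quad\max\{\langle\mu,r\rangle:\ L_0\mu=\nu,\ L_1\mu\ge y,\ \mu\in\mathcal M_w(K),\ \mu\ge0\}$$ is $$\text{(D)}\quad\begin{aligned}\min\quad&\langle h,\nu\rangle-\langle\Lambda,y\rangle\\ \text{s.t.}\quad& r-L_0^*h+L_1^*\Lambda\le0\ \text{ on }K,\\ & h\in\mathcal F_{\hat w}(S),\ \Lambda\in\mathcal M([a,b]),\ \Lambda\ge0.\end{aligned}$$ The optimal values of (P) and (D) are equal, and (D) is solvable (its optimal value is attained).
   Context: **Setting (discounted reward).** $S$ and $A$ are Borel spaces (Borel subsets of complete separable metric spaces); $A(s)\in\mathcal B(A)$ for $s\in S$; $K=\{(s,a): a\in A(s)\}$ is closed in $S\times A$; $Q(\cdot\mid s,a)$ is a stochastic kernel on $S$ given $K$; $r,z:K\to\mathbb R$ are measurable; $\delta\in(0,1)$ is the discount factor; $\nu$ is a Borel probability measure on $S$ (initial distribution). $(x)_-=\min\{x,0\}$. $Y$ is a real random variable with support in a compact interval $[a,b]$ and $y(\eta)=\mathbb E[(Y-\eta)_-]$, $\eta\in[a,b]$. (P) is the occupation-measure form of maximizing $\mathbb E^\pi_\nu[\sum_t\delta^t r(s_t,a_t)]$ subject to $\mathbb E^\pi_\nu[\sum_t\delta^t(z(s_t,a_t)-\eta)_-]\ge y(\eta)$ for all $\eta\in[a,b]$. **Spaces and operators.** Let $w=1-r$ on $K$ and $\hat w(s)=1-\sup_{a\in A(s)}r(s,a)$ on $S$.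 $\mathcal M_w(K)$ is the space of signed Borel measures $\mu$ on $K$ with $\int_K w\,d|\mu|<\infty$; $\mathcal F_w(K)$ is the space of measurable $h:K\to\mathbb R$ with $\sup_K|h|/w<\infty$; $\langle\mu,h\rangle=\int_K h\,d\mu$. $\mathcal F_{\hat w}(S)$ is defined analogously, and $\langle h,\nu\rangle=\int_S h\,d\nu$. $\mathcal M([a,b])$ is the space of finite signed Borel measures on $[a,b]$, $\langle\Lambda,f\rangle=\int_a^b f\,d\Lambda$. $[L_0\mu](B)=\hat\mu(B)-\delta\int_K Q(B\mid s,a)\mu(d(s,a))$ ($\hat\mu$ = marginal on $S$), with adjoint $[L_0^*h](s,a)=h(s)-\delta\int_S h(\xi)Q(d\xi\mid s,a)$; $[L_1\mu](\eta)=\langle\mu,(z-\eta)_-\rangle$, with adjoint $[L_1^*\Lambda](s,a)=\int_a^b(z(s,a)-\eta)_-\Lambda(d\eta)$. **Meaning of ''dual''.** With Lagrangian $\vartheta(\mu,h,\Lambda)=\langle\mu,r\rangle+\langle h,L_0\mu-\nu\rangle+\langle\Lambda,L_1\mu-y\rangle$, the dual problem is $\inf_{h,\,\Lambda\ge0}\sup_{\mu\in\mathcal M_w(K),\mu\ge0}\vartheta(\mu,h,\Lambda)$, written with the unrestricted variable $h$ renamed $-h$. **Assumptions.** (1) (P) is feasible. (2) $r\le0$ and for every $\epsilon\ge0$ the set $\{(s,a)\in K: r(s,a)\ge-\epsilon\}$ is compact. (3) $z$ is bounded and upper semicontinuous on $K$. (4) $Q$ is weakly continuous: $\int_S h(\xi)Q(d\xi\mid\cdot)$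 is bounded continuous on $K$ for every bounded continuous $h$ on $S$. (5) $(z-\eta)_-\in\mathcal F_w(K)$ for all $\eta\in[a,b]$. (6) $\int_S\hat w(\xi)Q(d\xi\mid\cdot)\in\mathcal F_w(K)$. (7) There is a minimizing sequence $(h^n,\Lambda^n)$ of feasible points for (D) with $\{h^n\}$ bounded in $\mathcal F_{\hat w}(S)$ and $\{\Lambda^n\}$ bounded in the weak* topology on $\mathcal M([a,b])$. *)

(* Defs.v *)
From HB Require Import structures.
From mathcomp Require Import all_boot all_order all_algebra.
From mathcomp Require Import all_classical all_reals all_analysis.

Set Implicit Arguments.
Unset Strict Implicit.
Unset Printing Implicit Defensive.

Import Order.TTheory GRing.Theory Num.Theory.
Import numFieldNormedType.Exports.

Local Open Scope classical_set_scope.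
Local Open Scope ring_scope.

Definition borel (T : ptopologicalType) :
  measurableType (sigma_display (@open T)) := g_sigma_algebraType (@open T).

(* A Borel space: a topological space homeomorphic to a Borel subset (the range
   of [f], with its relative topology) of a complete separable metric space. *)
Definition borel_space (R : realType) (S : topologicalType) :=
  exists (X : metricType R) (f : S -> X),
    [/\ (forall F : set_system X, ProperFilter F -> cauchy F -> exists x : X, F --> nbhs x),
        (exists2 D : set X, countable D & dense D),
        injective f,
        (forall U : set S, open U <-> exists2 V : set X, open V & U = f @^-1` V)
      & <<s (@open X) >> (range f)].

(* The subset [D] as a topological space of its own, with the relative topology.
   Measurable types are pointed, hence the nonemptiness proof. *)
Definition subspace_type (T : topologicalType) (D : set T) (D0 : D !=set0) : Type :=
  set_type D.

Section subspace_type.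
Context (T : topologicalType) (D : set T) (D0 : D !=set0).

HB.instance Definition _ := Topological.on (subspace_type D0).
HB.instance Definition _ :=
  isPointed.Build (subspace_type D0) (exist (fun x => x \in D) _ (mem_set (projT2 (cid D0)))).

End subspace_type.

Section signed_measures.
Context d (T : measurableType d) (R : realType).
Implicit Types (mu : {charge set T -> \bar R}) (w h : T -> R).

Lemma hahn_ex mu : exists PN : set T * set T, hahn_decomposition mu PN.1 PN.2.
Proof. by have [P [N PN]] := Hahn_decomposition mu; exists (P, N). Qed.

Definition hahn mu : hahn_decomposition mu _ _ := projT2 (cid (hahn_ex mu)).

Definition total_variation mu : {measure set T -> \bar R} :=
  charge_variation (hahn mu).

(* <mu, h>, through the Jordan decomposition of mu; the result is meaningful
   only when h is integrable with respect to |mu|. *)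
Definition pairing mu h : R :=
  \int[jordan_pos (hahn mu)]_x h x - \int[jordan_neg (hahn mu)]_x h x.

Definition nonneg_charge mu := forall B, measurable B -> (0 <= mu B)%E.

Definition weighted_measures w : set ({charge set T -> \bar R}) :=
  [set mu | (\int[total_variation mu]_x (w x)%:E < +oo)%E].

Definition weighted_functions w : set (T -> R) :=
  [set h : T -> R | measurable_fun setT h /\ has_ubound (range (fun x => `|h x| / w x))].

Definition weighted_norm w h : R := sup (range (fun x => `|h x| / w x)).

End signed_measures.

Section kernel_action.
Context d d' (X : measurableType d) (Y : measurableType d') (R : realType).
Variable (Q : R.-pker X ~> Y).

Definition measure_kernel (m : {finite_measure set X -> \bar R}) (B : set Y) :
  \bar R := \int[m]_x Q x B.

Section measure_kernel.
Variable m : {finite_measure set X -> \bar R}.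

Let mk0 : measure_kernel m set0 = 0%E.
Proof.
by rewrite /measure_kernel (eq_integral (cst 0%E)) ?integral0 // => x _; rewrite measure0.
Qed.

Let mk_ge0 B : (0 <= measure_kernel m B)%E.
Proof. exact: integral_ge0. Qed.

Let mk_sigma_additive : semi_sigma_additive (measure_kernel m).
Proof.
move=> F mF tF mUF; rewrite [X in _ --> X](_ : _ =
    \int[m]_x (\sum_(n <oo) Q x (F n)))%E; last first.
  by apply: eq_integral => x _; apply/esym/cvg_lim => //; exact: measure_semi_sigma_additive.
apply/cvg_closeP; split.
  by apply: is_cvg_nneseries => n _ _; exact: integral_ge0.
rewrite closeE// integral_nneseries// => n.
exact: measurable_kernel.
Qed.

HB.instance Definition _ := isMeasure.Build _ _ R (measure_kernel m)
  mk0 mk_ge0 mk_sigma_additive.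

Let mk_fin : fin_num_fun (measure_kernel m).
Proof.
move=> B mB; rewrite ge0_fin_numE// /measure_kernel.
apply: (@le_lt_trans _ _ (\int[m]_x (cst 1%E x))%E).
  apply: ge0_le_integral => //; first exact: measurable_kernel.
  by move=> x _; rewrite -(@prob_kernel _ _ _ _ _ Q x); apply: le_measure; rewrite ?inE.
by rewrite integral_cst// mul1e; apply: fin_num_fun_lty; exact: fin_num_measure.
Qed.

HB.instance Definition _ := @Measure_isFinite.Build _ _ _ (measure_kernel m) mk_fin.

End measure_kernel.

(* B |-> \int Q(B | x) mu(dx) *)
Definition charge_kernel (mu : {charge set X -> \bar R}) : {charge set Y -> \bar R} :=
  cadd (charge_of_finite_measure (measure_kernel (jordan_pos (hahn mu))))
       (cscale (-1) (charge_of_finite_measure (measure_kernel (jordan_neg (hahn mu))))).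

End kernel_action.

Definition neg_part (R : realType) (x : R) : R := Num.min x 0.

(* y(eta) = E[(Y - eta)_-] *)
Definition benchmark (R : realType) d (Omega : measurableType d)
    (P : probability Omega R) (Y : {RV P >-> R}) (eta : R) : R :=
  fine 'E_P[fun omega => neg_part (Y omega - eta)].

Definition bounded_fct (T : Type) (R : realType) (f : T -> R) : Prop :=
  exists C : R, forall x, `|f x| <= C.

Definition upper_semicontinuous (T : topologicalType) (R : realType) (f : T -> R) :=
  lower_semicontinuous (fun x => (- f x)%:E).

(* Boundedness for the weak-* topology on the dual of C(T), T compact. *)
Definition weakly_star_bounded (R : realType) (T : ptopologicalType)
    (Lam : nat -> {charge set (borel T) -> \bar R}) : Prop :=
  forall f : T -> R, continuous f -> bounded_fct (fun n => pairing (Lam n) f).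

Definition graph (S U : Type) (A : S -> set U) : set (S * U) :=
  [set sa | A sa.1 sa.2].

Lemma graph_neq0 (S : pointedType) (U : Type) (A : S -> set U) :
  (forall s, A s !=set0) -> graph A !=set0.
Proof. by move=> A0; have [u Au] := A0 point; exists (point, u). Qed.

Lemma itv_neq0 (R : realType) (a b : R) : a <= b -> `[a, b] !=set0.
Proof. by move=> ab; exists a; rewrite /= in_itv /= lexx ab. Qed.

Definition admissible (S U : ptopologicalType) (A : S -> set U)
  (A0 : forall s, A s !=set0) : ptopologicalType := subspace_type (graph_neq0 A0).

Definition compact_itv (R : realType) (a b : R) (ab : a <= b) : ptopologicalType :=
  subspace_type (itv_neq0 ab).

Section operators.
Context (R : realType) (S U : ptopologicalType) (A : S -> set U).
Variable A0 : forall s, A s !=set0.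
Local Notation K := (admissible A0).

Definition state (k : K) : S := (set_val k).1.

Lemma continuous_state : continuous state.
Proof.
move=> k; apply: (@continuous_comp _ _ _ (set_val : K -> S * U) fst).
  exact: initial_continuous.
exact: cvg_fst.
Qed.

Lemma measurable_state : measurable_fun [set: borel K] (state : borel K -> borel S).
Proof.
apply: (@measurability _ _ (borel K) (borel S) setT state (@open S)) => //.
move=> _ [B oB <-]; rewrite setTI; apply: sub_sigma_algebra.
by move/continuousP : continuous_state; apply.
Qed.

Section marginal.
Variable mu : {charge set (borel K) -> \bar R}.

Definition marginal (B : set (borel S)) : \bar R := mu (state @^-1` B).

Let measurable_preim (B : set (borel S)) : measurable B ->
  measurable (state @^-1` B : set (borel K)).
Proof. by move=> mB; rewrite -[X in measurable X]setTI; exact: measurable_state. Qed.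

Let marginal0 : marginal set0 = 0%E.
Proof. by rewrite /marginal preimage_set0 charge0. Qed.

Let marginal_fin (B : set (borel S)) : measurable B -> marginal B \is a fin_num.
Proof. by move=> mB; apply: fin_num_measure; exact: measurable_preim. Qed.

Let marginal_sigma_additive : semi_sigma_additive marginal.
Proof.
move=> F mF tF mUF; rewrite /marginal preimage_bigcup.
apply: charge_semi_sigma_additive.
- by move=> n; exact: measurable_preim.
- apply/trivIsetP => /= i j _ _ ij; rewrite -preimage_setI.
  by move/trivIsetP : tF => /(_ _ _ _ _ ij) ->//; rewrite preimage_set0.
- by rewrite -preimage_bigcup; exact: measurable_preim.
Qed.

HB.instance Definition _ :=
  isCharge.Build _ _ _ marginal marginal0 marginal_fin marginal_sigma_additive.

End marginal.

(* [L0 mu](B) = mu(B x A) - delta * \int_K Q(B | s, a) mu(d(s, a)) *)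
Definition L0 (Q : R.-pker (borel K) ~> (borel S)) (delta : R)
    (mu : {charge set (borel K) -> \bar R}) : {charge set (borel S) -> \bar R} :=
  cadd (marginal mu) (cscale (- delta) (charge_kernel Q mu)).

Definition L0_adj (Q : R.-pker (borel K) ~> (borel S)) (delta : R)
    (h : S -> R) (k : K) : R :=
  h (state k) - delta * \int[Q k]_s h s.

Definition L1 (z : K -> R) (mu : {charge set (borel K) -> \bar R}) (eta : R) : R :=
  pairing mu (fun k => neg_part (z k - eta)).

Definition L1_adj (z : K -> R) (a b : R) (ab : a <= b)
    (Lam : {charge set (borel (compact_itv ab)) -> \bar R}) (k : K) : R :=
  pairing Lam (fun eta : compact_itv ab => neg_part (z k - set_val eta)).

Definition weight (r : K -> R) (k : K) : R := 1 - r k.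

Definition state_weight (r : K -> R) (s : S) : R :=
  1 - sup [set r k | k in [set k | state k = s]].

End operators.

Section programs.
Context (R : realType) (S U : ptopologicalType) (A : S -> set U).
Variables (A0 : forall s, A s !=set0) (Q : R.-pker (borel (admissible A0)) ~> (borel S)).
Variables (delta : R) (r z : admissible A0 -> R) (nu : probability (borel S) R).
Variables (a b : R) (ab : a <= b) (y : R -> R).
Local Notation K := (admissible A0).
Local Notation I := (compact_itv ab).
Implicit Types (mu : {charge set (borel K) -> \bar R}) (h : S -> R).
Implicit Types (Lam : {charge set (borel I) -> \bar R}).

Definition primal_feasible mu : Prop :=
  [/\ weighted_measures (weight r : borel K -> R) mu, nonneg_charge mu,
      (forall B, measurable B -> L0 Q delta mu B = nu B)
    & forall eta, eta \in `[a, b] -> y eta <= L1 z mu eta].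

Definition primal_value : \bar R :=
  ereal_sup [set (pairing mu (r : borel K -> R))%:E | mu in primal_feasible].

Definition dual_feasible h Lam : Prop :=
  [/\ weighted_functions (state_weight r : borel S -> R) h, nonneg_charge Lam
    & forall k, r k - L0_adj Q delta h k + L1_adj z Lam k <= 0].

Definition dual_objective h Lam : R :=
  \int[nu]_s h s - pairing Lam (fun eta => y (set_val eta)).

Definition dual_value : \bar R :=
  ereal_inf [set (dual_objective p.1 p.2)%:E | p in [set p | dual_feasible p.1 p.2]].

Definition lagrangian mu h Lam : R :=
  pairing mu r
  + pairing (cadd (L0 Q delta mu) (copp (charge_of_finite_measure nu))) h
  + pairing Lam (fun eta => L1 z mu (set_val eta) - y (set_val eta)).

(* the supremum of the Lagrangian over mu >= 0 in M_w(K) *)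
Definition dual_function h Lam : \bar R :=
  ereal_sup [set (lagrangian mu h Lam)%:E | mu in
    [set mu | weighted_measures (weight r : borel K -> R) mu /\ nonneg_charge mu]].

Definition lagrangian_dual_value : \bar R :=
  ereal_inf [set dual_function p.1 p.2 | p in
    [set p | weighted_functions (state_weight r : borel S -> R) p.1 /\
             nonneg_charge p.2]].

End programs.

(* Main.v *)
Require Import Defs.
From HB Require Import structures.
From mathcomp Require Import all_boot all_order all_algebra finmap.
From mathcomp Require Import all_classical all_reals all_analysis.
From mathcomp Require Import measurable_realfun ring lra.

Set Implicit Arguments.
Unset Strict Implicit.
Unset Printing Implicit Defensive.

Import Order.TTheory GRing.Theory Num.Theory.
Import numFieldNormedType.Exports.

Local Open Scope classical_set_scope.
Local Open Scope ring_scope.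

(* Dual function. Fubini's theorem turns the Lagrangian of [mu >= 0] into the
   dual objective plus the [mu]-integral of the slack [r - L0* h + L1* Lam]; Dirac
   measures show that its supremum is infinite unless the slack is nonpositive.

   No gap. Fix a real [q], and let [h] range over bounded continuous functions
   only. If some slack, shifted by [1 - delta] times the difference of its
   objective and [q], is nonpositive, then adding a constant to [h] makes it dual
   feasible with objective [q]. Otherwise a theorem of the alternative yields, for
   every finite set of shifted slacks, a finitely supported probability under which
   all of them have nonnegative expectation. An ultrafilter refining these gives a
   positive functional, tight because the superlevel sets of [r] are compact, and
   Topsoe's construction represents it by a measure on [K]; upper semicontinuity of
   [r] and [z] preserves the inequalities. Up to the factor [1 - delta] this measure
   is primal feasible with value at least [q].

   Attainment. Along a minimizing sequence extract a weak-* convergent subsequence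
   of the multipliers, and take for [h] the pointwise lower limit of the [h^n];
   Fatou's lemma preserves feasibility and the bound on the objective. *)

(** * A convex theorem of the alternative *)

(** A limit of probabilities along an ultrafilter respects continuous integrands exactly, but other
    integrands only up to a one-sided inequality. The equality constraint is therefore tested
    against bounded continuous [h] alone: weak continuity of [Q] keeps [L0_adj Q delta h] bounded
    and continuous, and such [h] still determine a finite measure on a Borel space, so the limit
    satisfies the full constraint. For [r] and [z] the single inequality that semicontinuity gives
    has the right direction.

    The factor [1 - delta] is the value of [L0_adj] at the constant 1. Equivalently, every feasible
    measure has total mass [(1 - delta)^-1], so that feasible measures are rescaled probabilities,
    and adding a constant to [h] trades objective against slack at this rate.

    The limit measure first satisfies one inequality that mixes [r], [h] and a multiplier. Since [h]
    and the multiplier can be scaled while [q] is fixed and [r] is nonpositive, that inequality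
    splits into the separate constraints.

    In the attainment part, lower limits have the right direction because feasibility bounds [h]
    from below at the current state by an expression increasing in [h] at the next one. *)

Section kneser.
Context (R : realType) (X : Type) (mix : R -> X -> X -> X).

Definition mix_closed (D : set X) :=
  forall t x y, 0 <= t <= 1 -> D x -> D y -> D (mix t x y).

Definition affine (g : X -> R) :=
  forall t x y, 0 <= t <= 1 -> g (mix t x y) = t * g x + (1 - t) * g y.

(** The points [(a x, b x)] form a convex subset of the plane that avoids the region [0 <= a],
    [0 < b], and a line through the origin separates the two. Its slope [l] is the supremum of
    [b x / - a x] over the points with [a x < 0 < b x]; [cross] bounds these quotients by any
    [- b y / a y] with [0 < a y], and [l / (l + 1)] normalizes the multiplier. *)
Lemma two_functions_combination (D : set X) (a b : X -> R) :
  mix_closed D -> affine a -> affine b ->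
  (forall x, D x -> 0 <= a x -> b x <= 0) ->
  exists2 t, 0 <= t <= 1 & forall x, D x -> t * a x + (1 - t) * b x <= 0.
Proof.
move=> Dmix aff_a aff_b ab.
have [[x2 [Dx2 ax2]]|noa] := pselect (exists x, D x /\ 0 < a x); last first.
  exists 1; first by rewrite ler01 lexx.
  move=> x Dx; rewrite subrr mul0r addr0 mul1r leNgt.
  by apply/negP => ax; apply: noa; exists x.
have cross x y : D x -> a x < 0 -> D y -> 0 < a y ->
    b x / - a x <= - b y / a y.
  move=> Dx ax Dy ay.
  (* The weight at which [a] vanishes on the segment between [x] and [y]; the hypothesis then gives
     the sign of [b] at that point. *)
  pose s := a y / (a y - a x).
  have d0 : 0 < a y - a x by lra.
  have s01 : 0 <= s <= 1.
    rewrite /s divr_ge0 ?(ltW ay) ?(ltW d0)//= ler_pdivrMr// mul1r; lra.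
  have amix : a (mix s x y) = 0.
    by rewrite aff_a// /s; field; rewrite gt_eqF.
  have := ab _ (Dmix _ _ _ s01 Dx Dy); rewrite amix lexx => /(_ isT).
  rewrite aff_b// => bmix.
  have : (a y * b x - a x * b y) / (a y - a x) <= 0.
    apply: le_trans bmix; rewrite le_eqVlt; apply/orP; left; apply/eqP.
    by rewrite /s; field; rewrite gt_eqF.
  rewrite pmulr_lle0 ?invr_gt0// => h.
  rewrite ler_pdivrMr ?oppr_gt0// mulrAC ler_pdivlMr//; lra.
(* Including 0 keeps the set nonempty when there is no such [x], and makes its supremum
   nonnegative. *)
pose L := [set b x / - a x | x in [set x | D x /\ a x < 0 /\ 0 < b x]] `|` [set 0].
have ubL : ubound L (- b x2 / a x2).
  move=> _ [[x [Dx [ax _]] <-]|->]; first exact: cross.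
  by rewrite divr_ge0 ?(ltW ax2)// oppr_ge0; apply: ab => //; exact: ltW.
have supL : has_sup L by split; [exists 0; right|exists (- b x2 / a x2)].
pose l := sup L.
have l0 : 0 <= l by apply: ub_le_sup; [case: supL|right].
have l1 : 0 < l + 1 by lra.
exists (l / (l + 1)).
  by rewrite divr_ge0 ?(ltW l1)//= ler_pdivrMr// mul1r; lra.
move=> x Dx.
have -> : l / (l + 1) * a x + (1 - l / (l + 1)) * b x = (l * a x + b x) / (l + 1).
  by field; rewrite gt_eqF.
rewrite pmulr_lle0 ?invr_gt0//.
have [ax|ax|ax] := ltgtP (a x) 0; last 2 first.
- have : l <= - b x / a x.
    apply: ge_sup => [|_ [[y [Dy [ay _]] <-]|->]]; first by exists 0; right.
      exact: cross.
    by rewrite divr_ge0 ?(ltW ax)// oppr_ge0; apply: ab => //; exact: ltW.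
  rewrite ler_pdivlMr//; lra.
- by rewrite ax mulr0 add0r; apply: ab => //; rewrite ax.
have [bx|bx] := leP (b x) 0.
  by rewrite -oppr_ge0 opprD addr_ge0 ?oppr_ge0// mulr_ge0_le0// ltW.
have : b x / - a x <= l by apply: ub_le_sup; [case: supL|left; exists x].
by rewrite ler_pdivrMr ?oppr_gt0//; lra.
Qed.

(* Kneser's induction: the slack needed to add one more function is recovered
   by restricting [D] to the convex set where that function is nonnegative. *)
Lemma convex_alternative (F : set (X -> R)) :
  F !=set0 -> (forall g, F g -> affine g) ->
  (forall t g h, 0 <= t <= 1 -> F g -> F h ->
     F (fun x => t * g x + (1 - t) * h x)) ->
  forall n (g : nat -> X -> R) (D : set X), mix_closed D ->
    (forall i, (i < n)%N -> F (g i)) ->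
    (forall x, D x -> exists2 i, (i < n)%N & g i x < 0) ->
  exists2 h, F h & forall x, D x -> h x <= 0.
Proof.
move=> [g0 Fg0] Faff Fconv; elim=> [|n IH] g D Dmix Fg gD.
  by exists g0 => // x /gD[].
have Fgn : F (g n) by exact: Fg.
pose D' := [set x | D x /\ 0 <= g n x].
have [t x y t01 [Dx gx] [Dy gy]|i ni|x [Dx gx]|h Fh hD'] := IH g D'.
- split; first exact: Dmix.
  have /andP[t0 t1] := t01.
  by rewrite Faff// addr_ge0// mulr_ge0// subr_ge0.
- by apply: Fg; rewrite ltnS ltnW.
- have [i] := gD x Dx; rewrite ltnS leq_eqVlt => /orP[/eqP->|ni gi0].
    by rewrite ltNge gx.
  by exists i.
have [] := @two_functions_combination D (g n) h Dmix (Faff _ Fgn) (Faff _ Fh).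
  by move=> x Dx gx; exact: hD'.
by move=> t t01 tD; exists (fun x => t * g n x + (1 - t) * h x); [exact: Fconv|].
Qed.

End kneser.

(** * Measures from positive functionals on Hausdorff spaces *)

Section compact_separation.
Context (T : topologicalType).
Hypothesis hT : hausdorff_space T.

(** Compactness is used in its near-covering form: around each point of [D], some neighbourhood lies
    outside the closures of all sufficiently small neighbourhoods of [x], and compactness makes one
    neighbourhood of [x] serve all of [D]. *)
Lemma compact_point_separation (D : set T) x : compact D -> ~ D x ->
  exists2 W, nbhs x W & closure W `<=` ~` D.
Proof.
move=> /compact_near_coveringP cD Dx.
have [y Dy|M [MF _ [W MW] /(_ W MW) WD]] :=
    cD (set T) (powerset_filter_from (nbhs x)) (fun W y => ~ closure W y).
  have xy : x != y by apply/eqP => xy; rewrite xy in Dx.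
  move: hT; rewrite open_hausdorff => /(_ _ _ xy)[[A B] /=].
  rewrite !inE => -[Ax By] [oA oB AB0].
  exists (B, [set W | nbhs x W /\ W `<=` A]).
    split => /=; first exact: open_nbhs_nbhs.
    by apply: powerset_filter_fromP; exact: open_nbhs_nbhs.
  move=> [y' W] [/= By' [_ WA]] /(_ B)[|z [/WA Az Bz]].
    exact: open_nbhs_nbhs.
  by suff : (set0 : set T) z by []; rewrite -AB0.
by exists W; [exact: MF|move=> y Wy Dy; exact: WD Wy].
Qed.

(** The same covering argument with the point replaced by [E]: the filter [F] expresses that a
    property holds for all small enough open supersets of [E]. *)
Lemma compact_compact_separation (D E : set T) :
  compact D -> compact E -> D `&` E = set0 ->
  exists V, [/\ open V, E `<=` V & closure V `<=` ~` D].
Proof.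
move=> /compact_near_coveringP cD cE DE0.
pose O := [set V : set T | open V /\ E `<=` V].
pose F := filter_from O (fun V => [set W | O W /\ W `<=` V]).
have FF : Filter F.
  apply: filter_from_filter; first by exists setT; split => //; exact: openT.
  move=> P Q [oP EP] [oQ EQ]; exists (P `&` Q).
    by split; [exact: openI|move=> x Ex; split; [exact: EP|exact: EQ]].
  by move=> W [OW WPQ]; do 2!split => //; move=> x /WPQ[].
have [x Dx|V [oV EV] VD] := cD (set T) F (fun W y => ~ closure W y) FF.
  have Ex : ~ E x by move=> Ex; suff : (set0 : set T) x by []; rewrite -DE0.
  have [W /nbhs_interior Wx WE] := compact_point_separation cE Ex.
  exists (W°, [set V | O V /\ V `<=` ~` closure W]).
    split => //=; exists (~` closure W) => //; split; last by move=> z Ez /WE.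
    exact/closed_openC/closed_closure.
  move=> [y1 V] [/= Wy1 [_ VW]] /(_ W°)[|z [/VW Wz Wz0]].
    by apply: open_nbhs_nbhs; split => //; exact: open_interior.
  by apply: Wz; apply: subset_closure; exact: interior_subset.
exists V; split => // y Vy Dy.
by have /= VVD := VD V (conj (conj oV EV) (@subset_refl _ V)); exact: (VVD y Dy Vy).
Qed.

(** The parts of [C] outside [G] and outside [H] are disjoint compact sets. An open [V] separating
    them cuts [C] into its trace on the closure of [V] and its trace off [V]. This is what makes the
    inner content subadditive on open sets. *)
Lemma compact_split (C G H : set T) : compact C -> open G -> open H ->
  C `<=` G `|` H ->
  exists D E, [/\ compact D, compact E, D `<=` G, E `<=` H & C `<=` D `|` E].
Proof.
move=> cC oG oH CGH.
have cmp A : closed A -> compact (C `&` A).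
  by move=> cA; apply: (subclosed_compact _ cC) => //; apply: closedI => //; exact: compact_closed.
have [|V [oV CV Vcl]] := @compact_compact_separation (C `&` ~` G) (C `&` ~` H)
    (cmp _ (open_closedC oG)) (cmp _ (open_closedC oH)).
  by rewrite -subset0 => x [[Cx Gx] [_ Hx]]; case: (CGH x Cx).
exists (C `&` closure V), (C `&` ~` V); split.
- exact/cmp/closed_closure.
- exact/cmp/open_closedC.
- by move=> x [Cx /Vcl GCx]; apply: contrapT => Gx; apply: GCx.
- by move=> x [Cx Vx]; apply: contrapT => Hx; apply: Vx; exact: CV.
- move=> x Cx; have [Vx|Vx] := pselect (V x); last by right.
  by left; split => //; exact: subset_closure.
Qed.

End compact_separation.

Lemma measurable_open (T : ptopologicalType) (G : set (borel T)) :
  open (G : set T) -> measurable G.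
Proof. exact: sub_sigma_algebra. Qed.

Lemma measurable_closed (T : ptopologicalType) (F : set (borel T)) :
  closed (F : set T) -> measurable F.
Proof.
move=> cF; rewrite -(setCK F); apply: measurableC; apply: measurable_open.
exact: closed_openC.
Qed.

Lemma compact_bigcup_nat (T : ptopologicalType) (C : set T) (F : (set T)^nat) :
  compact C -> (forall n, open (F n)) -> C `<=` \bigcup_n F n ->
  exists N, C `<=` \big[setU/set0]_(n < N) F n.
Proof.
rewrite compact_cover => cC oF CF.
have [n _|x /CF[n _ Fnx]|D _ CD] := cC nat setT F; [exact: oF|by exists n|].
exists (\max_(i <- D) i).+1 => x /CD[n Dn Fnx].
rewrite -bigcup_mkord; exists n => //=; rewrite ltnS.
exact: leq_bigmax_seq.
Qed.

Section inner_regular_extension.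
Context (R : realType) (T : ptopologicalType) (l : set (borel T) -> R).
Hypothesis hT : hausdorff_space T.
Hypothesis l_ge0 : forall A, measurable A -> 0 <= l A.
Hypothesis lU : forall A B, measurable A -> measurable B -> A `&` B = set0 ->
  l (A `|` B) = l A + l B.

Let measurable_compact (C : set (borel T)) : compact (C : set T) -> measurable C.
Proof. by move=> cC; apply: measurable_closed; exact: compact_closed. Qed.

Let l_le A B : measurable A -> measurable B -> A `<=` B -> l A <= l B.
Proof.
move=> mA mB AB; rewrite -(setDUK AB) lU//; last 2 first.
- exact: measurableD.
- by rewrite setDIK.
by rewrite lerDl l_ge0//; exact: measurableD.
Qed.

Let l_leU A B : measurable A -> measurable B -> l (A `|` B) <= l A + l B.
Proof.
move=> mA mB; have -> : A `|` B = A `|` (B `\` A).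
  apply/seteqP; split => x; last by move=> [Ax|[Bx _]]; [left|right].
  by have [Ax _|Ax [//|Bx]] := pselect (A x); [left|right].
rewrite lU//; last 2 first.
- exact: measurableD.
- by rewrite setDIK.
by rewrite lerD2l l_le//; exact: measurableD.
Qed.

Let l0 : l set0 = 0.
Proof.
have /= := lU (@measurable0 _ (borel T)) (@measurable0 _ (borel T)) (setI0 _).
by rewrite setU0 => /eqP; rewrite eq_sym -subr_eq0 addrK => /eqP.
Qed.

Local Open Scope ereal_scope.

Definition inner_content (G : set T) : \bar R :=
  ereal_sup [set (l C)%:E | C in [set C | compact C /\ C `<=` G]].

Definition inner_outer (E : set T) : \bar R :=
  ereal_inf [set inner_content G | G in [set G | open G /\ E `<=` G]].

Local Notation rho := inner_content.
Local Notation mus := inner_outer.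

Let rho_ge G C : compact C -> C `<=` G -> (l C)%:E <= rho G.
Proof. by move=> cC CG; apply: ereal_sup_ubound; exists C. Qed.

Let rho_ge0 G : 0 <= rho G.
Proof.
have := @rho_ge G set0 (@compact0 _) (@sub0set _ _).
by rewrite l0.
Qed.

Let rho_leT G : rho G <= (l setT)%:E.
Proof.
apply: ge_ereal_sup => _ [C [cC _] <-]; rewrite lee_fin l_le//.
exact: measurable_compact.
Qed.

Let rho_fin G : rho G \is a fin_num.
Proof. by rewrite ge0_fin_numE// (le_lt_trans (rho_leT G))// ltry. Qed.

Let le_rho G H : G `<=` H -> rho G <= rho H.
Proof.
move=> GH; apply: ge_ereal_sup => _ [C [cC CG] <-].
by apply: rho_ge => //; exact: subset_trans GH.
Qed.

Let rhoU G H : open G -> open H -> rho (G `|` H) <= rho G + rho H.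
Proof.
move=> oG oH; apply: ge_ereal_sup => _ [C [cC CGH] <-].
have [D [E [cD cE DG EH CDE]]] := compact_split hT cC oG oH CGH.
apply: (@le_trans _ _ ((l D)%:E + (l E)%:E)); last by apply: leeD; exact: rho_ge.
have mD := measurable_compact cD; have mE := measurable_compact cE.
rewrite -EFinD lee_fin (le_trans _ (l_leU mD mE))// l_le//.
  exact: measurable_compact.
exact: measurableU.
Qed.

(** A compact set inside the union is already covered by finitely many of the open sets, so the
    countable case reduces to the finite one. *)
Let rho_bigcup (F : (set T)^nat) : (forall n, open (F n)) ->
  rho (\bigcup_n F n) <= \sum_(n <oo) rho (F n).
Proof.
move=> oF; apply: ge_ereal_sup => _ [C [cC CF] <-].
have [N CN] := compact_bigcup_nat cC oF CF.
have step n : open (\big[setU/set0]_(i < n) F i) /\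
    rho (\big[setU/set0]_(i < n) F i) <= \sum_(i < n) rho (F i).
  elim: n => [|n [on IH]].
    rewrite !big_ord0; split; first exact: open0.
    apply: ge_ereal_sup => _ [D [_ D0] <-].
    by rewrite subset0 in D0; rewrite D0 l0.
  rewrite !big_ord_recr/=; split; first exact: openU.
  by apply: le_trans (rhoU on (oF n)) _; exact: leeD2r.
apply: le_trans (rho_ge cC CN) _; apply: le_trans (step N).2 _.
rewrite -(big_mkord xpredT (fun i => rho (F i))).
by apply: nneseries_lim_ge => n _ _; exact: rho_ge0.
Qed.

Let mus_ge0 E : 0 <= mus E.
Proof. by apply: le_ereal_inf_tmp => _ [G _ <-]; exact: rho_ge0. Qed.

Let mus_open G : open G -> mus G = rho G.
Proof.
move=> oG; apply/eqP; rewrite eq_le; apply/andP; split.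
  by apply: ereal_inf_lbound; exists G => //; split.
by apply: le_ereal_inf_tmp => _ [H [_ GH] <-]; exact: le_rho.
Qed.

Let mus_fin E : mus E \is a fin_num.
Proof.
rewrite ge0_fin_numE//; apply: (@le_lt_trans _ _ (rho setT)).
  by apply: ereal_inf_lbound; exists setT => //; split => //; exact: openT.
by rewrite -ge0_fin_numE.
Qed.

Let mus0 : mus set0 = 0.
Proof.
rewrite mus_open; last exact: open0.
apply/eqP; rewrite eq_le rho_ge0 andbT.
apply: ge_ereal_sup => _ [D [_ D0] <-].
by rewrite subset0 in D0; rewrite D0 l0.
Qed.

Let mus_adherent E (e : R) : (0 < e)%R ->
  exists G, [/\ open G, E `<=` G & rho G <= mus E + e%:E].
Proof.
move=> e0; have [_ [G [oG EG] <-] h] := lb_ereal_inf_adherent e0 (mus_fin E).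
by exists G; split => //; exact: ltW.
Qed.

Let mus_sub (A : set T) (F : (set T)^nat) : subset_sigma_subadditive mus A F.
Proof.
move=> AF; apply/lee_addgt0Pr => e e0.
apply: le_trans (epsilon_trick _ _ (ltW e0)); last by [].
have en n : (0 < e / (2 ^ n.+1)%:R)%R by rewrite divr_gt0// ltr0n expn_gt0.
have /choice[G GF] := fun n => mus_adherent (F n) (en n).
apply: (@le_trans _ _ (rho (\bigcup_n G n))).
  apply: ereal_inf_lbound; exists (\bigcup_n G n) => //; split.
    by apply: bigcup_open => n _; case: (GF n).
  by apply: (subset_trans AF); apply: subset_bigcup => n _; case: (GF n).
apply: (le_trans (rho_bigcup _)) => [n|]; first by case: (GF n).
apply: lee_nneseries => [n _ _|n _]; first exact: rho_ge0.
by case: (GF n).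
Qed.

HB.instance Definition _ := isSubsetOuterMeasure.Build R T mus mus0 mus_ge0 mus_sub.

Let rho_adherent G (e : R) : (0 < e)%R ->
  exists C, [/\ compact C, C `<=` G & rho G <= (l C + e)%:E].
Proof.
move=> e0; have [_ [C [cC CG] <-] h] := ub_ereal_sup_adherent e0 (rho_fin G).
by exists C; split => //; rewrite EFinD -leeBlDr//; exact: ltW.
Qed.

(** [C] nearly exhausts [V] inside [G], and [D] nearly exhausts what remains of [V] after removing
    [C] rather than [G]. This remainder is open and still contains the part of [X] outside [G],
    while [C] and [D] are disjoint, so additivity of [l] gives the inequality up to three errors
    [e / 3]. *)
Let open_caratheodory G : open G -> mus.-caratheodory G.
Proof.
move=> oG; apply: le_caratheodory_measurable => X.
apply/lee_addgt0Pr => e e0.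
have e3 : (0 < e / 3)%R by rewrite divr_gt0.
have [V [oV XV hV]] := mus_adherent X e3.
have [C [cC CVG hC]] := rho_adherent (V `&` G) e3.
have oVC : open (V `&` ~` C).
  by apply: openI => //; apply: closed_openC; exact: compact_closed.
have [D [cD DVC hD]] := rho_adherent (V `&` ~` C) e3.
have h1 : mus (X `&` G) <= rho (V `&` G).
  apply: ereal_inf_lbound; exists (V `&` G) => //.
  by split; [exact: openI|exact: setSI].
have h2 : mus (X `&` ~` G) <= rho (V `&` ~` C).
  apply: ereal_inf_lbound; exists (V `&` ~` C) => //; split => //.
  by move=> x [Xx Gx]; split; [exact: XV|move=> /CVG[]].
have h3 : (l C + l D)%:E <= rho V.
  rewrite -lU; last 3 first.
  - exact: measurable_compact.
  - exact: measurable_compact.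
  - by rewrite -subset0 => x [Cx /DVC[]].
  by apply: rho_ge; [exact: compactU|move=> x [/CVG[]|/DVC[]]].
apply: (le_trans (leeD (le_trans h1 hC) (le_trans h2 hD))).
rewrite -EFinD addrACA EFinD.
apply: le_trans (leeD2r _ (le_trans h3 hV)) _.
rewrite -addeA leeD2l// -EFinD lee_fin; lra.
Qed.

Let borel_caratheodory (A : set (borel T)) : measurable A -> mus.-caratheodory A.
Proof.
move: A; apply: smallest_sub => //; split.
- exact: caratheodory_measurable_set0.
- by move=> A mA; rewrite setTD; exact: caratheodory_measurable_setC.
- by move=> F mF; exact: caratheodory_measurable_bigcup.
Qed.

Definition inner_measure (A : set (borel T)) : \bar R := mus A.

Let inner_measure0 : inner_measure set0 = 0.
Proof. exact: mus0. Qed.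

Let inner_measure_ge0 A : 0 <= inner_measure A.
Proof. exact: mus_ge0. Qed.

Let inner_measure_sigma_additive : semi_sigma_additive inner_measure.
Proof.
move=> F mF tF mUF; rewrite /inner_measure.
apply: caratheodory_measure_sigma_additive => //.
  by move=> i; exact: (borel_caratheodory (mF i)).
exact: borel_caratheodory.
Qed.

HB.instance Definition _ := isMeasure.Build _ _ _ inner_measure
  inner_measure0 inner_measure_ge0 inner_measure_sigma_additive.

Let inner_measure_fin : fin_num_fun inner_measure.
Proof. by move=> A _; exact: mus_fin. Qed.

HB.instance Definition _ := @Measure_isFinite.Build _ _ _ inner_measure inner_measure_fin.

(* Topsoe's construction: inner regularize [l] on open sets, then take the outer
   measure this induces. *)
Lemma inner_regular_extension :
  exists m : {finite_measure set (borel T) -> \bar R},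
    (forall G : set T, open G -> m G <= (l G)%:E) /\
    (forall C : set T, compact C -> (l C)%:E <= m C).
Proof.
exists inner_measure; split => [G oG|C cC].
  rewrite [leLHS](mus_open oG); apply: ge_ereal_sup => _ [C [cC CG] <-].
  rewrite lee_fin l_le//; [exact: measurable_compact|exact: measurable_open].
by apply: le_ereal_inf_tmp => _ [G [oG CG] <-]; exact: rho_ge.
Qed.

End inner_regular_extension.

(** * Representation of tight positive functionals *)

Section positive_functional.
Context (R : realType) (T : ptopologicalType) (I : (T -> R) -> R).
Hypothesis hT : hausdorff_space T.

Definition bounded_borel (f : T -> R) :=
  measurable_fun [set: borel T] (f : borel T -> R) /\ bounded_fct f.

Hypothesis I_ge0 : forall f, bounded_borel f -> (forall x, 0 <= f x) -> 0 <= I f.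
Hypothesis ID : forall f g, bounded_borel f -> bounded_borel g ->
  I (fun x => f x + g x) = I f + I g.
Hypothesis IZ : forall c f, bounded_borel f -> I (fun x => c * f x) = c * I f.
Hypothesis I_tight : forall e : R, 0 < e ->
  exists2 C : set T, compact C & I \1_(~` C) <= e.

Lemma bounded_borelD f g : bounded_borel f -> bounded_borel g ->
  bounded_borel (fun x => f x + g x).
Proof.
move=> [mf [c fc]] [mg [k gk]]; split; first exact: measurable_funD.
by exists (c + k) => x; rewrite (le_trans (ler_normD _ _))// lerD.
Qed.

Lemma bounded_borelZ c f : bounded_borel f -> bounded_borel (fun x => c * f x).
Proof.
move=> [mf [k fk]]; split; first exact: measurable_funM.
by exists (`|c| * k) => x; rewrite normrM ler_wpM2l.
Qed.

Lemma bounded_borel_indic (A : set (borel T)) : measurable A -> bounded_borel \1_A.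
Proof.
move=> mA; split; first exact: measurable_indic.
by exists 1 => x; rewrite indicE; case: (_ \in _); rewrite ?normr1 ?normr0.
Qed.

Lemma bounded_borel_cst (c : R) : bounded_borel (fun=> c).
Proof. by split; [exact: measurable_cst|exists `|c|]. Qed.

Let I_le f g : bounded_borel f -> bounded_borel g -> (forall x, f x <= g x) -> I f <= I g.
Proof.
move=> bf bg fg.
have bd : bounded_borel (fun x => g x + -1 * f x).
  by apply: bounded_borelD => //; exact: bounded_borelZ.
have := I_ge0 bd; rewrite ID//; last exact: bounded_borelZ.
rewrite IZ// mulN1r subr_ge0; apply => x.
by rewrite mulN1r subr_ge0.
Qed.

Let I_sum n (f : nat -> T -> R) : (forall i, bounded_borel (f i)) ->
  bounded_borel (fun x => \sum_(i < n) f i x) /\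
  I (fun x => \sum_(i < n) f i x) = \sum_(i < n) I (f i).
Proof.
move=> bf; elim: n => [|n [bn In]].
  under eq_fun do rewrite big_ord0; split; first exact: bounded_borel_cst.
  rewrite big_ord0; have := IZ 0 (bounded_borel_cst 0).
  by under eq_fun do rewrite mul0r; rewrite mul0r.
under eq_fun do rewrite big_ord_recr/=.
by split; [exact: bounded_borelD|rewrite ID// In big_ord_recr].
Qed.

(** A staircase of [N] steps of height [e] that approximates [t] from below. With strict
    comparisons, each step of a lower semicontinuous function is a multiple of the indicator of an
    open set, and on open sets the constructed measure is bounded by the functional. *)
Definition layers (e : R) N (t : R) := \sum_(j < N) e * ((e * j.+1%:R < t)%R : bool)%:R.

(** The middle clause, that the staircase is full above its top level, serves the induction for the
    outer two. *)
Lemma layersP e N t : 0 < e -> 0 <= t ->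
  [/\ layers e N t <= t,
      e * N%:R < t -> layers e N t = e * N%:R
    & t <= e * N%:R -> t <= layers e N t + e].
Proof.
move=> e0 t0; elim: N => [|N [IH1 IH2 IH3]].
  by rewrite /layers big_ord0 mulr0; split => //; lra.
have S1 : e * N.+1%:R = e * N%:R + e by rewrite -natr1 mulrDr mulr1.
rewrite /layers big_ord_recr/= -/(layers e N t) S1.
have [lt|ge] := ltP (e * N%:R + e) t.
  rewrite mulr1 IH2; last lra.
  by split; lra.
rewrite mulr0 addr0; split => //.
move=> _; have [h|h] := ltP (e * N%:R) t; first by rewrite IH2//; lra.
exact: IH3.
Qed.

(** [I] is only finitely additive. The measure built from the indicators lies below [I] on open sets
    and above it on compact sets. Tightness turns the second bound into equality of total masses;
    the staircase turns the first into the inequality for lower semicontinuous functions. *)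
Lemma riesz_semicontinuous :
  exists m : {finite_measure set (borel T) -> \bar R},
    m setT = (I (cst 1))%:E /\
    forall f : T -> R, (forall x, 0 <= f x) -> bounded_fct f ->
      (forall a, open [set x | a < f x]) ->
      (\int[m]_x (f x)%:E <= (I f)%:E)%E.
Proof.
have [|A B mA mB AB|m [mG mC]] := @inner_regular_extension R T (fun A => I \1_A) hT.
- by move=> A mA; apply: I_ge0 => //; exact: bounded_borel_indic.
- rewrite -ID; [|exact: bounded_borel_indic|exact: bounded_borel_indic].
  congr I; apply/funext => x; rewrite !indicE in_setU.
  have : ~ (A x /\ B x) by move=> ABx; suff : (set0 : set T) x by []; rewrite -AB.
  have [/set_mem Ax|_] := boolP (x \in A); have [/set_mem Bx|_] := boolP (x \in B) => //=.
  + by move=> /(_ (conj Ax Bx)).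
  + by rewrite addr0.
  + by rewrite add0r.
  + by rewrite addr0.
have mT : m setT = (I (cst 1))%:E.
  have I1 : I \1_setT = I (cst 1) by rewrite indicT.
  apply/eqP; rewrite eq_le; apply/andP; split.
    by have := mG _ (@openT T); rewrite I1.
  apply/lee_addgt0Pr => e e0; have [C cC hC] := I_tight e0.
  have mCC : measurable (C : set (borel T)).
    by apply: measurable_closed; exact: compact_closed.
  apply: (@le_trans _ _ (m C + e%:E)%E).
    apply: le_trans (leeD2r _ (mC _ cC)); rewrite -EFinD lee_fin.
    apply: (@le_trans _ _ (I \1_C + I \1_(~` C))); last by rewrite lerD2l.
    rewrite -ID; last 2 first.
    - exact: bounded_borel_indic.
    - by apply: bounded_borel_indic; exact: measurableC.
    apply: I_le; [exact: bounded_borel_cst| |].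
      apply: bounded_borelD; apply: bounded_borel_indic => //; exact: measurableC.
    move=> x; rewrite !indicE in_setC; case: (_ \in _) => /=; lra.
  by apply: leeD2r; apply: le_measure; rewrite ?inE.
exists m; split => // f f0 [B fB] fo.
have bf : bounded_borel f.
  split; last by exists B.
  move=> mD; apply: (measurability _ (RGenOInfty.measurableE R)) => //.
  move=> _ [_ [a ->] <-]; rewrite setTI; apply: measurable_open.
  by rewrite preimage_itvoy.
pose M := fine (m setT).
have M0 : 0 <= M by apply: fine_ge0.
apply/lee_addgt0Pr => e' e'0.
(* The staircase falls short of [f] by at most [e], which costs [e * M] in the integral; the added 1
   keeps the denominator positive when [M] is 0. *)
pose e := e' / (M + 1).
have M1 : 0 < M + 1 by lra.
have e0 : 0 < e by rewrite divr_gt0.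
have [N BN] : exists N, B <= e * N%:R.
  exists (Num.truncn (B / e)).+1; rewrite mulrC -ler_pdivrMr//.
  exact/ltW/truncnS_gt.
have mS j : measurable ([set x | e * j.+1%:R < f x] : set (borel T)).
  exact: measurable_open.
pose g j x := e * \1_[set x | e * j.+1%:R < f x] x : R.
have lE x : layers e N (f x) = \sum_(j < N) g j x.
  apply: eq_bigr => j _; rewrite /g indicE; congr (_ * (nat_of_bool _)%:R).
  by apply/idP/idP; rewrite inE.
have bg j : bounded_borel (g j) by apply: bounded_borelZ; exact: bounded_borel_indic.
have [bS IS] := I_sum N bg.
apply: (@le_trans _ _ (\int[m]_x (layers e N (f x) + e)%:E)%E).
  apply: ge0_le_integral => //.
  - by move=> x _; rewrite lee_fin.
  - by apply/measurable_EFinP; case: bf.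
  - apply/measurable_EFinP; apply: measurable_funD => //.
    by under eq_fun do rewrite lE; case: bS.
  - move=> x _; rewrite lee_fin; have [_ _ h] := layersP N e0 (f0 x); apply: h.
    by rewrite (le_trans _ BN)// (le_trans _ (fB x))// ler_norm.
under eq_integral do rewrite lE EFinD.
rewrite ge0_integralD//; last 3 first.
  - move=> x _; rewrite lee_fin sumr_ge0// => j _.
    by rewrite mulr_ge0 ?(ltW e0)// indicE ler0n.
  - by apply/measurable_EFinP; case: bS.
  - by move=> x _; rewrite lee_fin ltW.
rewrite integral_cst//= mT; apply: leeD; last first.
  rewrite -mT -(@fineK _ (m setT)) ?fin_num_measure// -/M -EFinM lee_fin.
  by rewrite /e -mulrA ler_piMr ?(ltW e'0)// ler_pdivrMl//; lra.
apply: (@le_trans _ _ (I (fun x => \sum_(i < N) g i x))%:E); last first.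
  by rewrite lee_fin; apply: I_le => // x; rewrite -lE; case: (layersP N e0 (f0 x)).
rewrite IS; under eq_integral do rewrite -sumEFin.
rewrite ge0_integral_sum//; last 2 first.
  - by move=> j; apply/measurable_EFinP; case: (bg j).
  - by move=> j x _; rewrite lee_fin mulr_ge0 ?(ltW e0)// indicE ler0n.
rewrite -sumEFin; apply: lee_sum => j _; rewrite /g.
rewrite IZ; last exact: bounded_borel_indic.
under eq_integral do rewrite EFinM.
rewrite ge0_integralZl ?lee_fin ?(ltW e0)//; last first.
  by apply/measurable_EFinP; exact: measurable_indic.
rewrite integral_indic// setIT [leRHS]EFinM.
apply: lee_wpmul2l; first by rewrite lee_fin ltW.
exact: mG.
Qed.

End positive_functional.

Lemma continuous_borel_measurable (R : realType) (T : ptopologicalType) (f : T -> R) :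
  continuous f -> measurable_fun [set: borel T] (f : borel T -> R).
Proof.
move=> cf mD; apply: (measurability _ (RGenOInfty.measurableE R)) => //.
move=> _ [_ [a ->] <-]; rewrite setTI; apply: measurable_open.
by move/continuousP : cf; apply; rewrite set_itvE; exact: open_gt.
Qed.

Lemma continuous_bounded_borel (R : realType) (T : ptopologicalType) (f : T -> R) :
  continuous f -> bounded_fct f -> bounded_borel f.
Proof. by move=> cf bf; split => //; exact: continuous_borel_measurable. Qed.

Lemma bounded_borel_integrable (R : realType) (T : ptopologicalType)
    (m : {finite_measure set (borel T) -> \bar R}) (f : T -> R) :
  bounded_borel f -> m.-integrable setT (EFin \o f).
Proof.
move=> [mf [B fB]]; apply: (@le_integrable _ _ _ m setT _ _ (cst B%:E)) => //.
- exact/measurable_EFinP.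
- move=> x _ /=; rewrite lee_fin (le_trans (fB x))// ler_norm//.
- by apply: finite_measure_integrable_cst.
Qed.

(** For a bound [B] of [f], the inequality applies to the nonnegative functions [f + B] and
    [- f + B]. Equality of the total masses cancels the constant, which leaves both inequalities for
    [f]. *)
Lemma semicontinuous_limit_continuous (R : realType) (T : ptopologicalType)
    (m : {finite_measure set (borel T) -> \bar R}) (I : (T -> R) -> R) :
  (forall f g, bounded_borel f -> bounded_borel g ->
    I (fun x => f x + g x) = I f + I g) ->
  (forall c f, bounded_borel f -> I (fun x => c * f x) = c * I f) ->
  m setT = (I (cst 1))%:E ->
  (forall f : T -> R, (forall x, 0 <= f x) -> bounded_fct f ->
      (forall a, open [set x | a < f x]) ->
      (\int[m]_x (f x)%:E <= (I f)%:E)%E) ->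
  forall f, continuous f -> bounded_fct f -> \int[m]_x f x = I f.
Proof.
move=> ID IZ m1 mle f cf bf.
have half g : continuous g -> bounded_fct g -> \int[m]_x g x <= I g.
  move=> cg [B gB].
  have bg : bounded_borel g by apply: continuous_bounded_borel => //; exists B.
  have bB : bounded_borel (cst B : T -> R) by exact: bounded_borel_cst.
  have /(@bounded_borel_integrable _ _ m) ig := bg.
  have /(@bounded_borel_integrable _ _ m) iB := bB.
  have igB : m.-integrable setT (EFin \o (fun x => g x + cst B x)).
    by apply: bounded_borel_integrable; exact: bounded_borelD.
  have := mle (fun x => g x + cst B x).
  rewrite ID// (_ : cst B = fun x => B * cst 1 x); last first.
    by apply/funext => x; rewrite /= mulr1.
  rewrite (IZ B (cst 1)); last exact: bounded_borel_cst.
  have <- : fine (m setT) = I (cst 1) by rewrite m1.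
  have -> : (\int[m]_x (g x + B * cst 1 x)%:E)%E = (\int[m]_x (g x + B * cst 1 x))%:E.
    rewrite /Rintegral fineK//; apply: integrable_fin_num => //.
    by move: igB; apply: eq_integrable => // x _ /=; rewrite mulr1.
  rewrite lee_fin RintegralD//; last first.
    by move: iB; apply: eq_integrable => // x _ /=; rewrite mulr1.
  rewrite (_ : (fun x => B * cst 1 x) = cst B); last first.
    by apply/funext => x; rewrite /= mulr1.
  rewrite Rintegral_cst// lerD2r; apply.
  - by move=> x; have := gB x; rewrite ler_norml => /andP[]; rewrite /=; lra.
  - exists (B + B) => x; rewrite (le_trans (ler_normD _ _))// lerD//=.
    by rewrite mulr1 ger0_norm// (le_trans _ (gB point)).
  - move=> c; rewrite (_ : mkset _ = [set x | c - B < g x]); last first.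
      by apply/seteqP; split => x /=; rewrite mulr1; lra.
    by move/continuousP : cg => /(_ [set y | c - B < y]); apply; exact: open_gt.
apply/eqP; rewrite eq_le half//=.
have := half (fun x => -1 * f x) _ _.
have bbf := continuous_bounded_borel cf bf.
rewrite IZ// RintegralZl//; last exact: bounded_borel_integrable.
rewrite !mulN1r lerN2; apply.
  by move=> x; apply: cvgMl_tmp; exact: cf.
by case: bf => B fB; exists B => x; rewrite mulN1r normrN.
Qed.

(** * Limits of functionals along an ultrafilter *)

Section ultralimit.
Context (R : realType) (J : Type) (U : set_system J) (UU : UltraFilter U).
Implicit Types (u v : J -> R).

Definition ulim u : R := lim (u j @[j --> U]).

(** The values stay in a compact segment, so they have a cluster point along [U], and an ultrafilter
    converges to each of its cluster points. *)
Lemma ultra_bounded_cvg u : bounded_fct u -> u j @[j --> U] --> ulim u.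
Proof.
move=> [M uM]; apply/cvg_ex => /=.
have [|p [_ clp]] := @segment_compact R (- M) M (u @ U) _.
  by apply: (@filterE _ U) => j; rewrite /= in_itv/= -ler_norml; exact: uM.
exists p => A Ap; rewrite /= nbhs_simpl /=.
have [//|UA] := in_ultra_setVsetC (u @^-1` A) UU.
by have [x [/= nAx Ax]] := clp (~` A) A UA Ap.
Qed.

Lemma ulimD u v : bounded_fct u -> bounded_fct v ->
  ulim (fun j => u j + v j) = ulim u + ulim v.
Proof.
by move=> bu bv; apply: cvg_lim => //; apply: cvgD; exact: ultra_bounded_cvg.
Qed.

Lemma ulimZ c u : bounded_fct u -> ulim (fun j => c * u j) = c * ulim u.
Proof.
by move=> bu; apply: cvg_lim => //; apply: cvgMl_tmp; exact: ultra_bounded_cvg.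
Qed.

Lemma ulim_ge c u : bounded_fct u -> U [set j | c <= u j] -> c <= ulim u.
Proof.
by move=> bu Uu; apply: (@cvgr_to_ge J U _ R u) => //; exact: ultra_bounded_cvg.
Qed.

Lemma ulim_le c u : bounded_fct u -> U [set j | u j <= c] -> ulim u <= c.
Proof.
by move=> bu Uu; apply: (@cvgr_to_le J U _ R u) => //; exact: ultra_bounded_cvg.
Qed.

Context (T : ptopologicalType) (E : J -> (T -> R) -> R) (M : R).
Hypothesis hT : hausdorff_space T.
Hypothesis E_ge0 : forall j f, bounded_borel f -> (forall x, 0 <= f x) -> 0 <= E j f.
Hypothesis ED : forall j f g, bounded_borel f -> bounded_borel g ->
  E j (fun x => f x + g x) = E j f + E j g.
Hypothesis EZ : forall j c f, bounded_borel f -> E j (fun x => c * f x) = c * E j f.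
Hypothesis E1 : forall j, E j (cst 1) <= M.
Hypothesis E_tight : forall e : R, 0 < e ->
  exists2 C : set T, compact C & U [set j | E j \1_(~` C) <= e].

Lemma bounded_functional f : bounded_borel f -> bounded_fct (E ^~ f).
Proof.
move=> bf; have [_ [B fB]] := bf; exists (B * M) => j.
have bB : bounded_borel (cst B : T -> R) by exact: bounded_borel_cst.
have EB : E j (cst B) <= B * M.
  rewrite (_ : cst B = fun x => B * cst 1 x); last by apply/funext => x; rewrite mulr1.
  rewrite EZ; last exact: bounded_borel_cst.
  have : 0 <= B by rewrite (le_trans _ (fB point)).
  by move=> B0; rewrite ler_wpM2l.
have bN : bounded_borel (fun x => -1 * f x) by exact: bounded_borelZ.
have h1 : 0 <= E j (cst B) + E j f.
  rewrite -ED//; apply: E_ge0; first exact: bounded_borelD.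
  by move=> x /=; have := fB x; rewrite ler_norml => /andP[]; lra.
have h2 : 0 <= E j (cst B) - E j f.
  rewrite -[- E j f]mulN1r -EZ// -ED//; apply: E_ge0; first exact: bounded_borelD.
  by move=> x /=; have := fB x; rewrite ler_norml => /andP[]; lra.
by rewrite ler_norml; apply/andP; split; lra.
Qed.

(** The limit functional inherits positivity and linearity, and [E_tight] supplies what countable
    additivity needs. Tightness is asked only along [U]: the set of good indices may depend on
    [e]. *)
Lemma ultralimit_measure :
  exists m : {finite_measure set (borel T) -> \bar R},
    m setT = (ulim (E ^~ (cst 1)))%:E /\
    (forall f : T -> R, (forall x, 0 <= f x) -> bounded_fct f ->
      (forall a, open [set x | a < f x]) ->
      (\int[m]_x (f x)%:E <= (ulim (E ^~ f))%:E)%E) /\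
    forall f : T -> R, continuous f -> bounded_fct f ->
      \int[m]_x f x = ulim (E ^~ f).
Proof.
have uD f g : bounded_borel f -> bounded_borel g ->
    ulim (E ^~ (fun x => f x + g x)) = ulim (E ^~ f) + ulim (E ^~ g).
  move=> bf bg; rewrite -ulimD; [|exact: bounded_functional|exact: bounded_functional].
  by congr ulim; apply/funext => j; exact: ED.
have uZ c f : bounded_borel f -> ulim (E ^~ (fun x => c * f x)) = c * ulim (E ^~ f).
  move=> bf; rewrite -ulimZ; last exact: bounded_functional.
  by congr ulim; apply/funext => j; exact: EZ.
suff [m [m1 mle]] : exists m : {finite_measure set (borel T) -> \bar R},
    m setT = (ulim (E ^~ (cst 1)))%:E /\
    forall f : T -> R, (forall x, 0 <= f x) -> bounded_fct f ->
      (forall a, open [set x | a < f x]) ->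
      (\int[m]_x (f x)%:E <= (ulim (E ^~ f))%:E)%E.
  exists m; split => //; split => //.
  exact: (@semicontinuous_limit_continuous _ _ _ (fun f => ulim (E ^~ f))).
apply: (@riesz_semicontinuous R T (fun f => ulim (E ^~ f)) hT).
- move=> f bf f0; apply: ulim_ge; first exact: bounded_functional.
  by apply: filterE => j; exact: E_ge0.
- exact: uD.
- exact: uZ.
- move=> e e0; have [C cC UC] := E_tight e0; exists C => //.
  apply: ulim_le => //; apply: bounded_functional; apply: bounded_borel_indic.
  by apply: measurableC; apply: measurable_closed; exact: compact_closed.
Qed.

End ultralimit.

(** * Signed measures, kernels and integrals *)

Section pairing_theory.
Context d (T : measurableType d) (R : realType).
Implicit Types (mu : {charge set T -> \bar R}) (m : {finite_measure set T -> \bar R}).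

Lemma le_measure_integrable (m1 m2 : {measure set T -> \bar R}) (f : T -> \bar R) :
  (forall A, measurable A -> (m1 A <= m2 A)%E) ->
  m2.-integrable setT f -> m1.-integrable setT f.
Proof.
move=> m12 /integrableP[mf fm2]; apply/integrableP; split => //.
apply: le_lt_trans fm2; apply: ge0_le_measure_integral => //.
exact: measurableT_comp.
Qed.

Lemma Rintegral_measure_add (m1 m2 : {measure set T -> \bar R}) (f : T -> R) :
  m1.-integrable setT (EFin \o f) -> m2.-integrable setT (EFin \o f) ->
  \int[measure_add m1 m2]_x f x = \int[m1]_x f x + \int[m2]_x f x.
Proof.
move=> f1 f2; rewrite /Rintegral integral_measure_add// fineD//;
  exact: integrable_fin_num.
Qed.

Lemma sube_swap (a b c e : \bar R) : a \is a fin_num -> b \is a fin_num ->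
  c \is a fin_num -> e \is a fin_num ->
  (a - b = c - e -> c + b = a + e)%E.
Proof.
move: a b c e => [a||] [b||] [c||] [e||]//= _ _ _ _.
by move=> [h]; congr EFin; lra.
Qed.

Lemma sube_idem (a b : \bar R) : a \is a fin_num -> b \is a fin_num ->
  (a = a - b -> b = 0)%E.
Proof. by move: a b => [a||] [b||]//= _ _ [h]; congr EFin; lra. Qed.

Lemma addr_swap (a b c e : R) : a + b = c + e -> a - e = c - b.
Proof. by move=> h; lra. Qed.

(** The Jordan parts form the smallest decomposition: they are dominated by [m1] and [m2], so [h] is
    integrable for them, and adding crosswise gives two equal measures. Pairings can thus be
    computed from any convenient decomposition, without knowledge of the Hahn sets. *)
Lemma pairing_difference mu (m1 m2 : {measure set T -> \bar R}) (h : T -> R) :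
  fin_num_fun m1 -> fin_num_fun m2 ->
  (forall A, measurable A -> mu A = m1 A - m2 A)%E ->
  m1.-integrable setT (EFin \o h) -> m2.-integrable setT (EFin \o h) ->
  pairing mu h = \int[m1]_x h x - \int[m2]_x h x.
Proof.
move=> fm1 fm2 mu12 h1 h2; rewrite /pairing.
set jp := jordan_pos _; set jn := jordan_neg _.
have [[mP posP] [mN negN] _ _] := hahn mu.
have jpE A : measurable A -> jp A = mu (A `&` (projT1 (cid (hahn_ex mu))).1).
  by move=> mA; rewrite /jp jordan_posE cjordan_posE /crestr0 mem_set.
have jnE A : measurable A -> jn A = (- mu (A `&` (projT1 (cid (hahn_ex mu))).2))%E.
  by move=> mA; rewrite /jn jordan_negE cjordan_negE /crestr0 mem_set.
have jp1 A : measurable A -> (jp A <= m1 A)%E.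
  move=> mA; have mAP := measurableI _ _ mA mP.
  rewrite jpE// mu12//; apply: (@le_trans _ _ (m1 (A `&` (projT1 (cid (hahn_ex mu))).1))).
    by rewrite leeBlDr ?fm1 ?fm2// leeDl.
  by apply: le_measure; rewrite ?inE.
have jn2 A : measurable A -> (jn A <= m2 A)%E.
  move=> mA; have mAN := measurableI _ _ mA mN.
  rewrite jnE// mu12// oppeB ?fin_num_adde_defr ?fm1 ?fm2// addeC.
  apply: (@le_trans _ _ (m2 (A `&` (projT1 (cid (hahn_ex mu))).2))).
    by rewrite leeBlDr ?fm1 ?fm2// leeDl.
  by apply: le_measure; rewrite ?inE.
have hjp : jp.-integrable setT (EFin \o h) by exact: le_measure_integrable h1.
have hjn : jn.-integrable setT (EFin \o h) by exact: le_measure_integrable h2.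
have jm A : measurable A -> (measure_add jp m2 A = measure_add m1 jn A)%E.
  move=> mA; rewrite !measure_addE.
  have : (m1 A - m2 A = jp A - jn A)%E.
    by rewrite -mu12// (jordan_decomp (hahn mu) mA) /cadd/= cscaleN1.
  by apply: sube_swap; rewrite ?fin_num_measure ?fm1 ?fm2.
have : \int[measure_add jp m2]_x h x = \int[measure_add m1 jn]_x h x.
  by rewrite /Rintegral; congr fine; apply: eq_measure_integral => A mA _; exact: jm.
rewrite !Rintegral_measure_add//; exact: addr_swap.
Qed.

Lemma pairing_measure mu m (h : T -> R) :
  (forall A, measurable A -> mu A = m A) ->
  m.-integrable setT (EFin \o h) -> pairing mu h = \int[m]_x h x.
Proof.
move=> mum hm; have mh : measurable_fun setT h.
  by apply/measurable_EFinP; exact: measurable_int hm.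
rewrite (@pairing_difference mu m mzero)//.
- by rewrite /Rintegral integral_measure_zero subr0.
- by move=> A mA; rewrite mum// sube0.
- apply/integrableP; split; first exact/measurable_EFinP.
  by rewrite integral_measure_zero.
Qed.

(** Gives a charge the structure of a finite measure. The positive Jordan part makes this total on
    all charges; on nonnegative ones nothing is lost, by [measure_ofE]. *)
Definition measure_of mu : {finite_measure set T -> \bar R} := jordan_pos (hahn mu).

Lemma measure_ofE mu : nonneg_charge mu ->
  forall A, measurable A -> measure_of mu A = mu A.
Proof.
move=> mu0 A mA.
have [[mP posP] [mN negN] PN PN0] := hahn mu.
have -> : measure_of mu A = jordan_pos (hahn mu) A by [].
rewrite jordan_posE cjordan_posE /crestr0 mem_set// /crestr/=.
have mAP := measurableI _ _ mA mP; have mAN := measurableI _ _ mA mN.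
rewrite -[in RHS](setIT A) -PN setIUr chargeU//; last first.
  by rewrite setIACA PN0 setI0.
rewrite [X in (_ + X)%E](_ : _ = 0%E) ?adde0//.
apply/eqP; rewrite eq_le mu0// andbT; apply: negN => //; exact: subIsetr.
Qed.

Lemma pairing_nonneg mu (h : T -> R) : nonneg_charge mu ->
  (measure_of mu).-integrable setT (EFin \o h) ->
  pairing mu h = \int[measure_of mu]_x h x.
Proof.
by move=> mu0; apply: pairing_measure => A mA; rewrite measure_ofE.
Qed.

Lemma jordan_neg_nonneg mu : nonneg_charge mu ->
  forall A, measurable A -> jordan_neg (hahn mu) A = 0%E.
Proof.
move=> mu0 A mA.
apply: (@sube_idem (measure_of mu A)).
- exact: fin_num_measure.
- exact: fin_num_measure.
by rewrite {1}measure_ofE// (jordan_decomp (hahn mu) mA) /cadd/= cscaleN1.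
Qed.

Lemma total_variation_nonneg mu : nonneg_charge mu ->
  forall A, measurable A -> Defs.total_variation mu A = mu A.
Proof.
move=> mu0 A mA; rewrite /Defs.total_variation /charge_variation/=.
transitivity (measure_of mu A + jordan_neg (hahn mu) A)%E; first by [].
rewrite jordan_neg_nonneg// adde0; exact: measure_ofE.
Qed.

Lemma weighted_nonneg mu (w : T -> R) : nonneg_charge mu ->
  measurable_fun setT w -> (forall x, 0 <= w x) ->
  weighted_measures w mu <-> (measure_of mu).-integrable setT (EFin \o w).
Proof.
move=> mu0 mw w0.
have -> : weighted_measures w mu = (\int[measure_of mu]_x (w x)%:E < +oo)%E.
  rewrite /weighted_measures /mkset; congr (_ < _)%E.
  apply: eq_measure_integral => A mA _.
  exact: etrans (total_variation_nonneg mu0 mA) (esym (measure_ofE mu0 mA)).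
split=> [wmu|/integrableP[_]].
  apply/integrableP; split; first exact/measurable_EFinP.
  by under eq_integral do rewrite /= ger0_norm//.
by under eq_integral do rewrite /= ger0_norm//.
Qed.

Lemma weighted_integrable (m : {measure set T -> \bar R}) (w h : T -> R) :
  (forall x, 1 <= w x) ->
  m.-integrable setT (EFin \o w) -> weighted_functions w h ->
  m.-integrable setT (EFin \o h).
Proof.
move=> w1 wm [mh [C hC]].
apply: (@le_integrable _ _ _ m setT _ _ (fun x => C%:E * (w x)%:E)%E) => //.
- exact/measurable_EFinP.
- move=> x _ /=; rewrite lee_fin.
  have w0 : 0 < w x by rewrite (lt_le_trans _ (w1 x)).
  have : `|h x| / w x <= C by apply: hC; exists x.
  by rewrite ler_pdivrMr// => h1; rewrite (le_trans h1)// ler_norm.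
- exact: integrableZl.
Qed.

End pairing_theory.

Section constant_kernel.
Context d (X : measurableType d) (R : realType).
Variable m : {finite_measure set X -> \bar R}.

(* [measure_kernel Q m] is the composition of this kernel with [Q]. *)
Definition constant_kernel (_ : unit) : {measure set X -> \bar R} := m.

Let measurable_constant_kernel U :
  measurable U -> measurable_fun [set: unit] (constant_kernel ^~ U).
Proof. by move=> mU; exact: measurable_cst. Qed.

HB.instance Definition _ :=
  @isKernel.Build _ _ _ _ R constant_kernel measurable_constant_kernel.

Let constant_kernel_uub : measure_fam_uub constant_kernel.
Proof.
exists (fine (m setT) + 1) => x; rewrite /constant_kernel.
by rewrite EFinD fineK ?fin_num_measure// lteDl ?fin_num_measure// lte01.
Qed.

HB.instance Definition _ :=
  @Kernel_isFinite.Build _ _ _ _ R constant_kernel constant_kernel_uub.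

End constant_kernel.

Section integral_measure_kernel.
Context d d' (X : measurableType d) (Y : measurableType d') (R : realType).
Variables (Q : R.-pker X ~> Y) (m : {finite_measure set X -> \bar R}).

Lemma ge0_integral_measure_kernel (f : Y -> \bar R) :
  (forall y, 0 <= f y)%E -> measurable_fun setT f ->
  (\int[measure_kernel Q m]_y f y = \int[m]_x \int[Q x]_y f y)%E.
Proof.
move=> f0 mf.
exact: (@integral_kcomp _ _ _ _ _ _ R (constant_kernel m) (kernel.kernel_snd Q) tt f f0 mf).
Qed.

Lemma Rintegral_measure_kernel (h : Y -> R) :
  (forall x, (Q x).-integrable setT (EFin \o h)) ->
  (measure_kernel Q m).-integrable setT (EFin \o h) ->
  m.-integrable setT (EFin \o (fun x => \int[Q x]_y h y)) /\
  \int[measure_kernel Q m]_y h y = \int[m]_x \int[Q x]_y h y.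
Proof.
move=> hQ hmk; have mE := measurable_int _ hmk.
have mh : measurable_fun setT h by exact/measurable_EFinP.
have mQ U : measurable U -> measurable_fun [set: X] (Q ^~ U).
  exact: measurable_kernel.
have QE x : ((\int[Q x]_y h y)%:E = \int[Q x]_y (h y)%:E)%E.
  by rewrite /Rintegral fineK//; exact: integrable_fin_num.
have part g : (forall y, 0 <= g y)%E -> measurable_fun setT g ->
    (measure_kernel Q m).-integrable setT g ->
    m.-integrable setT (fun x => \int[Q x]_y g y)%E.
  move=> g0 mg /integrableP[_ gmk]; apply/integrableP; split.
    exact: measurable_fun_integral_kernel.
  under eq_integral do rewrite gee0_abs ?integral_ge0//.
  rewrite -ge0_integral_measure_kernel//; apply: le_lt_trans gmk.
  by under [in leRHS]eq_integral do rewrite gee0_abs//.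
have pp := part _ (funepos_ge0 _) (measurable_funepos mE) (integrable_funepos measurableT hmk).
have pn := part _ (funeneg_ge0 _) (measurable_funeneg mE) (integrable_funeneg measurableT hmk).
have E1 : EFin \o (fun x => \int[Q x]_y h y) = fun x => (\int[Q x]_y (EFin \o h)^\+ y -
    \int[Q x]_y (EFin \o h)^\- y)%E.
  by apply/funext => x; rewrite /= QE [LHS]integralE.
split; first by rewrite E1; exact: integrableB.
rewrite {1}/Rintegral [X in fine X]integralE.
rewrite ge0_integral_measure_kernel//; last exact: measurable_funepos.
rewrite ge0_integral_measure_kernel//; last exact: measurable_funeneg.
rewrite -integralB// /Rintegral; congr fine.
by apply: eq_integral => x _; rewrite QE [RHS]integralE.
Qed.

End integral_measure_kernel.

Lemma eq_measure_Rintegral d (T : measurableType d) (R : realType)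
    (m1 m2 : {measure set T -> \bar R}) (h : T -> R) :
  (forall A, measurable A -> m1 A = m2 A) -> \int[m1]_x h x = \int[m2]_x h x.
Proof.
by move=> m12; rewrite /Rintegral; congr fine; apply: eq_measure_integral => A mA _; exact: m12.
Qed.

Lemma eq_measure_integrable d (T : measurableType d) (R : realType)
    (m1 m2 : {measure set T -> \bar R}) (h : T -> \bar R) :
  (forall A, measurable A -> m1 A = m2 A) ->
  m1.-integrable setT h -> m2.-integrable setT h.
Proof. by move=> m12; apply: le_measure_integrable => A mA; rewrite m12. Qed.

Lemma Rintegral_image d d' (X : measurableType d) (Y : measurableType d') (R : realType)
    (phi : X -> Y) (m : {measure set X -> \bar R}) (m1 : {measure set Y -> \bar R})
    (h : Y -> R) : measurable_fun setT phi ->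
  (forall A, measurable A -> m1 A = m (phi @^-1` A)) ->
  measurable_fun setT h -> m.-integrable setT (EFin \o (h \o phi)) ->
  m1.-integrable setT (EFin \o h) /\ \int[m1]_y h y = \int[m]_x h (phi x).
Proof.
move=> mphi m1E mh hm.
have mE : measurable_fun setT (EFin \o h) by exact/measurable_EFinP.
have hm' : m.-integrable (phi @^-1` setT) ((EFin \o h) \o phi) by rewrite preimage_setT.
split.
  apply: eq_measure_integrable (integrable_pushforward mphi mE hm' measurableT).
  by move=> A mA; rewrite m1E.
rewrite /Rintegral; congr fine.
have := integral_pushforward mphi mE hm' measurableT.
rewrite preimage_setT => /= <-; apply: eq_measure_integral => A mA _.
exact: m1E.
Qed.

Lemma Rintegral_mscale d (T : measurableType d) (R : realType) (k : {nonneg R})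
    (m : {measure set T -> \bar R}) (h : T -> R) : m.-integrable setT (EFin \o h) ->
  (mscale k m).-integrable setT (EFin \o h) /\
  \int[mscale k m]_x h x = k%:num * \int[m]_x h x.
Proof.
move=> hm; have mE := measurable_int _ hm.
split.
  move/integrableP : hm => [_ hm]; apply/integrableP; split => //.
  rewrite ge0_integral_mscale//; last exact: measurableT_comp.
  by rewrite lte_mul_pinfty// lee_fin.
have intp := integrable_fin_num measurableT (integrable_funepos measurableT hm).
have intn := integrable_fin_num measurableT (integrable_funeneg measurableT hm).
rewrite /Rintegral integralE [in RHS]integralE.
rewrite !ge0_integral_mscale//; [|exact: measurable_funeneg|exact: measurable_funepos].
by rewrite fineB ?fin_numM// fineM// fineM// [X in _ = _ * X](fineB intp intn) mulrBr.
Qed.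

Section pairing_L0.
Context (R : realType) (S U : ptopologicalType) (A : S -> set U).
Variable A0 : forall s, A s !=set0.
Local Notation K := (admissible A0).
Variables (Q : R.-pker (borel K) ~> (borel S)) (delta : R).
Variable mu : {charge set (borel K) -> \bar R}.
Hypothesis mu0 : nonneg_charge mu.
Local Notation m := (measure_of mu).

Lemma L0E (B : set (borel S)) : measurable B ->
  (L0 Q delta mu B = m (@state S U A A0 @^-1` B) - delta%:E * measure_kernel Q m B)%E.
Proof.
move=> mB; have mpB : measurable ((@state S U A A0 : borel K -> borel S) @^-1` B).
  by rewrite -[X in measurable X]setTI; exact: measurable_state.
have ckE : charge_kernel Q mu B = measure_kernel Q m B.
  transitivity (measure_kernel Q m B +
    (-1)%:E * measure_kernel Q (jordan_neg (hahn mu)) B)%E; first by [].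
  rewrite [X in (_ + _ * X)%E](_ : _ = 0%E) ?mule0 ?adde0//.
  rewrite /measure_kernel (eq_measure_integral mzero) ?integral_measure_zero//.
  by move=> C mC _; exact: (jordan_neg_nonneg mu0 mC).
transitivity (marginal (A0 := A0) mu B + (- delta)%:E * charge_kernel Q mu B)%E.
  by [].
by rewrite ckE measure_ofE// EFinN mulNe.
Qed.

Lemma pairing_L0 (nu : probability (borel S) R) (h : borel S -> R) : 0 <= delta ->
  (forall k, (Q k).-integrable setT (EFin \o h)) ->
  m.-integrable setT (EFin \o (fun k : borel K => h (@state S U A A0 k))) ->
  (measure_kernel Q m).-integrable setT (EFin \o h) ->
  nu.-integrable setT (EFin \o h) ->
  m.-integrable setT (EFin \o (L0_adj Q delta h : borel K -> R)) /\
  pairing (cadd (L0 Q delta mu) (copp (charge_of_finite_measure nu))) h =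
    \int[m]_k L0_adj Q delta h k - \int[nu]_s h s.
Proof.
move=> d0 hQ hm hmk hnu.
have mh : measurable_fun setT h by apply/measurable_EFinP; exact: measurable_int hnu.
have [hQm RQ] := Rintegral_measure_kernel hQ hmk.
have hQdm : m.-integrable setT (EFin \o (fun k => delta * \int[Q k]_s h s)).
  exact: (integrableZl measurableT delta hQm).
have mono : nonneg_charge (marginal (A0 := A0) mu).
  move=> B mB; apply: mu0; rewrite -[X in measurable X]setTI.
  exact: measurable_state.
have mmE B : measurable B -> measure_of (marginal (A0 := A0) mu) B =
    m (@state S U A A0 @^-1` B).
  move=> mB; rewrite measure_ofE// measure_ofE//.
  by rewrite -[X in measurable X]setTI; exact: measurable_state.
have [h1 R1] := @Rintegral_image _ _ _ _ R _ m _ h (@measurable_state S U A A0) mmE mh hm.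
have [h2 R2] := @Rintegral_mscale _ _ R (NngNum d0) (measure_kernel Q m) h hmk.
have hE : (EFin \o (L0_adj Q delta h : borel K -> R)) =
    ((EFin \o (fun k : borel K => h (@state S U A A0 k))) \-
    (EFin \o (fun k => (delta * \int[Q k]_s h s)%R)))%E by [].
split; first by rewrite hE; exact: integrableB.
have h3 : (measure_add (mscale (NngNum d0) (measure_kernel Q m)) nu).-integrable setT (EFin \o h).
  move/integrableP : (h2) => [mE h2']; move/integrableP : (hnu) => [_ hnu'].
  apply/integrableP; split => //.
  rewrite ge0_integral_measure_add//; last exact: measurableT_comp.
  by rewrite lte_add_pinfty.
pose m2 : {measure set (borel S) -> \bar R} :=
  measure_add (mscale (NngNum d0) (measure_kernel Q m)) nu.
have m2E B : (m2 B = delta%:E * measure_kernel Q m B + nu B)%E.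
  exact: (measure_addE (mscale (NngNum d0) (measure_kernel Q m)) nu B).
rewrite (@pairing_difference _ _ _ _ (measure_of (marginal (A0 := A0) mu)) m2).
- rewrite Rintegral_measure_add// R1 R2/= /L0_adj RintegralB// RintegralZl// RQ.
  by rewrite opprD addrA.
- by move=> B mB; exact: fin_num_measure.
- by move=> B mB; rewrite m2E fin_numD fin_numM ?fin_num_measure.
- move=> B mB; rewrite m2E [X in (X - _)%E](mmE _ mB).
  transitivity (L0 Q delta mu B - nu B)%E; first by [].
  rewrite L0E// fin_num_oppeD ?fin_num_measure// addeA//.
- exact: h1.
- exact: h3.
Qed.

End pairing_L0.

Section bounded_fubini.
Context d1 d2 (X : measurableType d1) (Y : measurableType d2) (R : realType).
Variables (m1 : {finite_measure set X -> \bar R}) (m2 : {finite_measure set Y -> \bar R}).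

Lemma bounded_integrable d (Z : measurableType d) (m : {finite_measure set Z -> \bar R})
    (g : Z -> R) : measurable_fun setT g -> bounded_fct g ->
  m.-integrable setT (EFin \o g).
Proof.
move=> mg [B gB]; apply: (@le_integrable _ _ _ m setT _ _ (EFin \o cst B)) => //.
- exact/measurable_EFinP.
- by move=> x _ /=; rewrite lee_fin (le_trans (gB x))// ler_norm.
- exact: finite_measure_integrable_cst.
Qed.

Lemma bounded_integrable_prod (f : X * Y -> R) :
  measurable_fun setT f -> bounded_fct f ->
  (m1 \x m2)%E.-integrable setT (EFin \o f).
Proof.
move=> mf [B fB].
have mE : measurable_fun setT (EFin \o f) by exact/measurable_EFinP.
apply: (proj2 (@integrable12ltyP _ _ X Y R m1 m2 (EFin \o f) mE)).
apply: (@le_lt_trans _ _ (\int[m1]_x (B%:E * m2 setT))%E).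
  apply: ge0_le_integral => //.
  - by move=> x _; exact: integral_ge0.
  - apply: (measurable_fun_fubini_tonelli_F (abse \o (EFin \o f))) => //=.
    by apply: measurableT_comp.
  - move=> x _; rewrite -integral_cst//; apply: ge0_le_integral => //.
    + apply: measurableT_comp => //; apply/measurable_EFinP.
      by apply: measurableT_comp => //; exact: pair1_measurable.
    + by move=> y _; rewrite /= lee_fin.
rewrite integral_cst// -ge0_fin_numE; first by rewrite !fin_numM// fin_num_measure.
by rewrite !mule_ge0// lee_fin (le_trans _ (fB point)).
Qed.

Lemma bounded_section_integrable (f : X * Y -> R) :
  measurable_fun setT f -> bounded_fct f ->
  m1.-integrable setT (EFin \o (fun x => \int[m2]_y f (x, y))) /\
  (forall x, (\int[m2]_y f (x, y))%:E = \int[m2]_y (f (x, y))%:E)%E.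
Proof.
move=> mf [B fB].
have i2 x : m2.-integrable setT (EFin \o (fun y => f (x, y))).
  apply: bounded_integrable; last by exists B.
  by apply: measurableT_comp => //; exact: pair1_measurable.
have E2 x : ((\int[m2]_y f (x, y))%:E = \int[m2]_y (f (x, y))%:E)%E.
  by rewrite /Rintegral fineK//; exact: (integrable_fin_num measurableT (i2 x)).
split=> //.
rewrite (_ : EFin \o _ = fubini_F m2 (EFin \o f)); last by apply/funext => x; rewrite /= E2.
apply: (@integrable_fubini_F _ _ _ _ _ m1); apply: bounded_integrable_prod => //.
by exists B.
Qed.

End bounded_fubini.

Lemma bounded_Rintegral_swap d1 d2 (X : measurableType d1) (Y : measurableType d2)
    (R : realType) (m1 : {finite_measure set X -> \bar R})
    (m2 : {finite_measure set Y -> \bar R}) (f : X * Y -> R) :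
  measurable_fun setT f -> bounded_fct f ->
  [/\ m1.-integrable setT (EFin \o (fun x => \int[m2]_y f (x, y))),
      m2.-integrable setT (EFin \o (fun y => \int[m1]_x f (x, y))) &
      \int[m1]_x \int[m2]_y f (x, y) = \int[m2]_y \int[m1]_x f (x, y)].
Proof.
move=> mf bf.
have [iF E2] := bounded_section_integrable m1 m2 mf bf.
have [||iG E1] := @bounded_section_integrable _ _ Y X R m2 m1 (fun yx => f (yx.2, yx.1)).
- by apply: measurableT_comp => //; exact: measurable_swap.
- by case: bf => B fB; exists B => yx; exact: fB.
split => //.
rewrite /Rintegral; congr fine.
under eq_integral do rewrite -[fine _]/(\int[m2]_y f (_, y)) E2.
under [RHS]eq_integral do rewrite -[fine _]/(\int[m1]_x f (x, _)) E1.
by apply: (@Fubini _ _ _ _ R m1 m2 (EFin \o f)); exact: bounded_integrable_prod.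
Qed.

(** * The Lagrangian *)

Lemma RintegralN d (T : measurableType d) (R : realType) (m : {measure set T -> \bar R})
    (h : T -> R) : m.-integrable setT (EFin \o h) ->
  \int[m]_x - h x = - \int[m]_x h x.
Proof.
move=> hm; rewrite -mulN1r -RintegralZl//; apply: eq_Rintegral => x _.
by rewrite mulN1r.
Qed.

Lemma ler_norm_neg_part (R : realType) (x : R) : `|neg_part x| <= `|x|.
Proof. by rewrite /neg_part; case: (leP x 0) => x0; rewrite ?normr0. Qed.

Lemma neg_part_measurable d (T : measurableType d) (R : realType) (f : T -> R) :
  measurable_fun setT f -> measurable_fun setT (fun x => neg_part (f x)).
Proof. by move=> mf; apply: measurable_minr. Qed.

Section compact_interval.
Context (R : realType) (a b : R) (ab : a <= b).
Local Notation I := (compact_itv ab).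

Lemma itv_val_bounds (eta : I) : a <= set_val eta <= b.
Proof. by have := set_valP eta; rewrite /= in_itv. Qed.

Lemma itv_val_norm (eta : I) : `|set_val eta| <= `|a| + `|b|.
Proof.
have /andP[ae eb] := itv_val_bounds eta.
have := ler_norm b; have := ler_norm (- a); rewrite normrN => ha hb.
have := normr_ge0 a; have := normr_ge0 b => hb0 ha0.
by rewrite ler_norml; apply/andP; split; lra.
Qed.

Lemma itv_val_continuous : continuous (fun eta : I => set_val eta).
Proof. exact: initial_continuous. Qed.

Lemma itv_val_measurable : measurable_fun [set: borel I] (fun eta : borel I => set_val eta).
Proof. exact: continuous_borel_measurable itv_val_continuous. Qed.

End compact_interval.

Section lagrangian_formula.
Context (R : realType) (S U : ptopologicalType) (A : S -> set U).
Variables (A0 : forall s, A s !=set0) (Q : R.-pker (borel (admissible A0)) ~> (borel S)).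
Variables (delta : R) (r z : admissible A0 -> R) (nu : probability (borel S) R).
Variables (a b : R) (ab : a <= b) (y : R -> R).
Local Notation K := (admissible A0).
Local Notation I := (compact_itv ab).
Local Notation w := (weight r : borel K -> R).
Local Notation sw := (state_weight r : borel S -> R).
Implicit Types (mu : {charge set (borel K) -> \bar R}) (h : S -> R).
Implicit Types (Lam : {charge set (borel I) -> \bar R}).
Hypothesis delta_ge0 : 0 <= delta.
Hypothesis r_le0 : forall k, r k <= 0.
Hypothesis mr : measurable_fun [set: borel K] r.
Hypothesis mz : measurable_fun [set: borel K] z.
Hypothesis bz : bounded_fct z.
Hypothesis swQ : forall k, (Q k).-integrable setT (EFin \o sw).
Hypothesis swQw : weighted_functions w (fun k => \int[Q k]_s state_weight r s).
Hypothesis swnu : nu.-integrable setT (EFin \o sw).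
Hypothesis yb : bounded_borel (fun eta : I => y (set_val eta)).

Lemma weight_ge1 k : 1 <= w k.
Proof. by rewrite /weight; have := r_le0 k; lra. Qed.

Lemma state_weight_ge1 s : 1 <= sw s.
Proof.
rewrite /state_weight lerBrDr gerDl.
have [u Au] := A0 s.
have ks : (s, u) \in graph A by rewrite inE.
apply: ge_sup; first by exists (r (exist _ (s, u) ks)), (exist _ (s, u) ks).
by move=> _ [k _ <-].
Qed.

Lemma state_weight_le k : sw (@state S U A A0 k) <= w k.
Proof.
rewrite /state_weight /weight lerB//; apply: ub_le_sup; last by exists k.
by exists 0 => _ [k' _ <-].
Qed.

Lemma measurable_state_weight : measurable_fun setT sw.
Proof. by apply/measurable_EFinP; exact: measurable_int swnu. Qed.

Lemma measurable_weight : measurable_fun setT w.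
Proof. by apply: measurable_funB => //; exact: measurable_cst. Qed.

Let wdom (m : {measure set (borel K) -> \bar R}) (g : borel K -> R) C :
  m.-integrable setT (EFin \o w) -> measurable_fun setT g ->
  (forall k, `|g k| <= C * w k) -> m.-integrable setT (EFin \o g).
Proof.
move=> wm mg gC; apply: (weighted_integrable weight_ge1 wm); split => //.
exists C => _ [k _ <-]; rewrite ler_pdivrMr//.
by rewrite (lt_le_trans _ (weight_ge1 k)).
Qed.

Definition slack h Lam (k : K) := r k - L0_adj Q delta h k + L1_adj z Lam k.

Let f (kn : borel K * borel I) : R := neg_part (z kn.1 - set_val kn.2).

Let mf : measurable_fun setT f.
Proof.
apply: neg_part_measurable; apply: measurable_funB.
  exact: measurableT_comp.
apply: measurableT_comp => //; exact: itv_val_measurable.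
Qed.

Let bf : bounded_fct f.
Proof.
have [B zB] := bz; exists (B + (`|a| + `|b|)) => -[k eta].
rewrite (le_trans (ler_norm_neg_part _))// (le_trans (ler_normB _ _))//.
by rewrite lerD//; exact: itv_val_norm.
Qed.

Lemma pairing_neg_part mu (eta : I) : nonneg_charge mu ->
  L1 z mu (set_val eta) = \int[measure_of mu]_k neg_part (z k - set_val eta).
Proof.
move=> mu0; apply: pairing_nonneg => //; apply: bounded_integrable.
  apply: neg_part_measurable; apply: measurable_funB => //; exact: measurable_cst.
by have [B fB] := bf; exists B => k; exact: (fB (k, eta)).
Qed.

Lemma L1_adjE Lam k : nonneg_charge Lam ->
  L1_adj z Lam k = \int[measure_of Lam]_eta neg_part (z k - set_val eta).
Proof.
move=> L0; apply: pairing_nonneg => //; apply: bounded_integrable.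
  apply: neg_part_measurable; apply: measurable_funB; first exact: measurable_cst.
  exact: itv_val_measurable.
by have [B fB] := bf; exists B => eta; exact: (fB (k, eta)).
Qed.

Lemma pairing_bounded_borel Lam (g : I -> R) : nonneg_charge Lam -> bounded_borel g ->
  pairing Lam g = \int[measure_of Lam]_eta g eta.
Proof.
by move=> L0 bg; apply: pairing_nonneg => //; exact: bounded_borel_integrable.
Qed.

Lemma weighted_kernel_integrable h k : weighted_functions sw h ->
  (Q k).-integrable setT (EFin \o h).
Proof. by move=> wh; exact: weighted_integrable state_weight_ge1 (swQ k) wh. Qed.

(** Integrability rests on a chain of dominations: [h] by a multiple of [sw], [sw] at the current
    state by [w], the [Q]-integral of [sw] by a multiple of [w], and [w] is integrable for [mu]. The
    exchange of the [mu] and [Lam] integrals only meets a bounded integrand, because [z] and the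
    interval are bounded. *)
Lemma slack_integrable mu h Lam : nonneg_charge mu -> weighted_measures w mu ->
  weighted_functions sw h -> nonneg_charge Lam ->
  [/\ (measure_of mu).-integrable setT (EFin \o r),
      (measure_of mu).-integrable setT (EFin \o (L0_adj Q delta h : borel K -> R)),
      (measure_of mu).-integrable setT (EFin \o (L1_adj z Lam : borel K -> R)),
      pairing (cadd (L0 Q delta mu) (copp (charge_of_finite_measure nu))) h =
        \int[measure_of mu]_k L0_adj Q delta h k - \int[nu]_s h s &
      pairing Lam (fun eta : I => L1 z mu (set_val eta) - y (set_val eta)) =
        \int[measure_of mu]_k L1_adj z Lam k - pairing Lam (fun eta : I => y (set_val eta))].
Proof.
move=> mu0 wmu wh Lam0; set m := measure_of mu.
have wm : m.-integrable setT (EFin \o w).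
  apply/(weighted_nonneg mu0 measurable_weight) => // k.
  by rewrite (le_trans _ (weight_ge1 k)).
have [mh [C hC]] := wh.
have hle s : `|h s| <= C * sw s.
  rewrite -ler_pdivrMr; first by apply: hC; exists s.
  by rewrite (lt_le_trans _ (state_weight_ge1 s)).
have C0 : 0 <= C.
  rewrite -(pmulr_lge0 _ (lt_le_trans ltr01 (state_weight_ge1 point))).
  by rewrite (le_trans _ (hle point)).
have rm : m.-integrable setT (EFin \o r).
  apply: (wdom (C := 1) wm mr) => k; rewrite mul1r ler0_norm// /weight.
  by lra.
have hm : m.-integrable setT (EFin \o (fun k : borel K => h (@state S U A A0 k))).
  apply: (wdom (C := C) wm).
    exact: measurableT_comp mh (@measurable_state _ _ _ A0).
  by move=> k; rewrite (le_trans (hle _))// ler_wpM2l// state_weight_le.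
have hQ k := weighted_kernel_integrable k wh.
(* Under the kernel image of [m], the integral of [sw] is the [m]-integral of its [Q]-integral, and
   the latter is dominated by [w]. *)
have swmk : (measure_kernel Q m).-integrable setT (EFin \o sw).
  apply/integrableP; split; first by apply/measurable_EFinP; exact: measurable_state_weight.
  rewrite (ge0_integral_measure_kernel Q m (f := fun s => `|(sw s)%:E|%E))//; last first.
    by apply: measurableT_comp => //; apply/measurable_EFinP; exact: measurable_state_weight.
  have /integrableP[_] := weighted_integrable weight_ge1 wm swQw.
  apply: le_lt_trans; apply: ge0_le_integral => //.
  - by move=> k _; exact: integral_ge0.
  - apply: (@measurable_fun_integral_kernel _ _ _ _ _ Q) => //.
      exact: measurable_kernel.
    by apply: measurableT_comp => //; apply/measurable_EFinP; exact: measurable_state_weight.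
  - by apply/measurable_EFinP/measurableT_comp => //; case: swQw.
  - move=> k _ /=; rewrite /Rintegral.
    have fin := integrable_fin_num measurableT (swQ k).
    rewrite (eq_integral (EFin \o sw)); last first.
      by move=> s _ /=; rewrite ger0_norm// (le_trans _ (state_weight_ge1 s)).
    by rewrite -[leLHS]fineK// lee_fin ler_norm.
have hmk := weighted_integrable state_weight_ge1 swmk wh.
have hnu := weighted_integrable state_weight_ge1 swnu wh.
have [L0m pL0] := @pairing_L0 R S U A A0 Q delta mu mu0 nu h delta_ge0 hQ hm hmk hnu.
have [F1 F2 F3] := bounded_Rintegral_swap m (measure_of Lam) mf bf.
split => //.
- move: F1; apply: eq_integrable => // k _; rewrite /= L1_adjE//.
- have L1E : (fun eta : borel I => L1 z mu (set_val eta)) =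
      (fun eta => \int[m]_k f (k, eta)).
    by apply/funext => eta; rewrite pairing_neg_part.
  rewrite pairing_nonneg//; last first.
    have := integrableB measurableT F2 (bounded_borel_integrable (measure_of Lam) yb).
    by apply: eq_integrable => // eta _ /=; rewrite pairing_neg_part.
  rewrite RintegralB//; last 2 first.
  - by rewrite L1E.
  - exact: bounded_borel_integrable.
  rewrite pairing_bounded_borel// L1E; congr (_ - _).
  by rewrite -F3; apply: eq_Rintegral => k _; rewrite L1_adjE.
Qed.

(** With [- h] as multiplier, the [L0] term contributes minus the integral of [L0_adj] of [h] and
    plus the [nu]-integral of [h]. All that depends on [mu] then collects into one integral of the
    slack, and the rest is the dual objective. *)
Lemma lagrangianE mu h Lam : nonneg_charge mu -> weighted_measures w mu ->
  weighted_functions sw h -> nonneg_charge Lam ->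
  (measure_of mu).-integrable setT (EFin \o (slack h Lam : borel K -> R)) /\
  lagrangian Q delta r z nu y mu (fun s => - h s) Lam =
    \int[measure_of mu]_k slack h Lam k + dual_objective nu y h Lam.
Proof.
move=> mu0 wmu wh Lam0.
have wNh : weighted_functions sw (fun s => - h s).
  have [mh [C hC]] := wh; split; first exact: measurableT_comp.
  by exists C => _ [s _ <-]; rewrite normrN; apply: hC; exists s.
have [rm L0m L1m _ _] := slack_integrable mu0 wmu wh Lam0.
have [_ L0Nm _ pL0 pL1] := slack_integrable mu0 wmu wNh Lam0.
have rL0m := integrableB measurableT rm L0m.
split; first exact: (integrableD measurableT rL0m L1m).
have L0N k : L0_adj Q delta (fun s => - h s) k = - L0_adj Q delta h k.
  rewrite /L0_adj RintegralN; last exact: weighted_kernel_integrable.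
  by rewrite mulrN opprD opprK.
rewrite /lagrangian pairing_nonneg// pL0 pL1 /slack RintegralD// RintegralB//.
rewrite /dual_objective.
have -> : \int[measure_of mu]_k L0_adj Q delta (fun s => - h s) k =
    - \int[measure_of mu]_k L0_adj Q delta h k.
  by rewrite -RintegralN//; apply: eq_Rintegral => k _; exact: L0N.
rewrite RintegralN; last exact: weighted_integrable state_weight_ge1 swnu wh.
rewrite opprK -!addrA; congr (_ + (_ + _)).
by rewrite addrCA.
Qed.

End lagrangian_formula.

Section finite_measure_charge.
Context d (T : measurableType d) (R : realType) (m : {finite_measure set T -> \bar R}).

Lemma nonneg_charge_of_finite_measure : nonneg_charge (charge_of_finite_measure m).
Proof. by move=> B mB; exact: measure_ge0. Qed.

End finite_measure_charge.

Lemma pairing_ge0 d (T : measurableType d) (R : realType)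
    (mu : {charge set T -> \bar R}) (g : T -> R) : nonneg_charge mu ->
  (forall x, 0 <= g x) -> 0 <= pairing mu g.
Proof.
move=> mu0 g0; rewrite /pairing.
rewrite [X in _ - X](@eq_measure_Rintegral _ _ _ _ mzero); last first.
  by move=> B mB; exact: (jordan_neg_nonneg mu0 mB).
rewrite [X in _ - X]/Rintegral integral_measure_zero subr0.
by apply: Rintegral_ge0.
Qed.

Lemma Rintegral_cscale d (T : measurableType d) (R : realType) (t : R)
    (m : {finite_measure set T -> \bar R}) : 0 <= t ->
  nonneg_charge (cscale t (charge_of_finite_measure m)) /\
  forall f : T -> R, m.-integrable setT (EFin \o f) ->
    (measure_of (cscale t (charge_of_finite_measure m))).-integrable setT (EFin \o f) /\
    \int[measure_of (cscale t (charge_of_finite_measure m))]_x f x = t * \int[m]_x f x.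
Proof.
move=> t0; have mu0 : nonneg_charge (cscale t (charge_of_finite_measure m)).
  by move=> B mB; rewrite mule_ge0 ?lee_fin//; exact: measure_ge0.
have E B : measurable B -> mscale (NngNum t0) m B =
    measure_of (cscale t (charge_of_finite_measure m)) B.
  by move=> mB; rewrite measure_ofE.
split => // f fm; have [f1 f2] := Rintegral_mscale (NngNum t0) fm; split.
  exact: eq_measure_integrable E f1.
by rewrite -(eq_measure_Rintegral f E).
Qed.

Lemma Rintegral_dirac d (T : measurableType d) (R : realType) (x : T) (f : T -> R) :
  measurable_fun setT f ->
  (\d_x : {measure set T -> \bar R}).-integrable setT (EFin \o f) /\
  \int[\d_x]_t f t = f x.
Proof.
move=> mf; have mE : measurable_fun setT (EFin \o f) by exact/measurable_EFinP.
split; last by rewrite /Rintegral integral_dirac// diracT mul1e.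
apply/integrableP; split => //.
rewrite integral_dirac//; last exact: measurableT_comp.
by rewrite diracT mul1e ltry.
Qed.

(** * The dual function and weak duality *)

Section dual_function.
Context (R : realType) (S U : ptopologicalType) (A : S -> set U).
Variables (A0 : forall s, A s !=set0) (Q : R.-pker (borel (admissible A0)) ~> (borel S)).
Variables (delta : R) (r z : admissible A0 -> R) (nu : probability (borel S) R).
Variables (a b : R) (ab : a <= b) (y : R -> R).
Local Notation K := (admissible A0).
Local Notation I := (compact_itv ab).
Local Notation w := (weight r : borel K -> R).
Local Notation sw := (state_weight r : borel S -> R).
Implicit Types (mu : {charge set (borel K) -> \bar R}) (h : S -> R).
Implicit Types (Lam : {charge set (borel I) -> \bar R}).
Hypothesis delta_ge0 : 0 <= delta.
Hypothesis r_le0 : forall k, r k <= 0.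
Hypothesis mr : measurable_fun [set: borel K] r.
Hypothesis mz : measurable_fun [set: borel K] z.
Hypothesis bz : bounded_fct z.
Hypothesis swQ : forall k, (Q k).-integrable setT (EFin \o sw).
Hypothesis swQw : weighted_functions w (fun k => \int[Q k]_s state_weight r s).
Hypothesis swnu : nu.-integrable setT (EFin \o sw).
Hypothesis yb : bounded_borel (fun eta : I => y (set_val eta)).

Let formula := lagrangianE delta_ge0 r_le0 mr mz bz swQ swQw swnu yb.

Let w_ge0 k : 0 <= w k.
Proof. by rewrite (le_trans _ (weight_ge1 r_le0 k)). Qed.

(** Tests the slack at a single point: [t = 0] shows that the dual objective is itself a value of
    the Lagrangian, and large [t] that the supremum is infinite as soon as some slack is
    positive. *)
Lemma lagrangian_dirac h Lam t k0 : 0 <= t ->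
  weighted_functions sw h -> nonneg_charge Lam ->
  exists mu, [/\ weighted_measures w mu, nonneg_charge mu &
    lagrangian Q delta r z nu y mu (fun s => - h s) Lam =
      t * slack Q delta r z h Lam k0 + dual_objective nu y h Lam].
Proof.
move=> t0 wh Lam0.
pose m : {finite_measure set (borel K) -> \bar R} := \d_(k0 : borel K).
have mw := measurable_weight mr.
have [mu0 muE] := Rintegral_cscale m t0.
exists (cscale t (charge_of_finite_measure m)).
have wmu : weighted_measures w (cscale t (charge_of_finite_measure m)).
  apply: (proj2 (weighted_nonneg mu0 mw w_ge0)); apply: (muE _ _).1.
  exact: (@Rintegral_dirac _ _ R (k0 : borel K) _ mw).1.
split => //; have [im ->] := formula mu0 wmu wh Lam0; congr (_ + _).
have ms : measurable_fun setT (slack Q delta r z h Lam : borel K -> R).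
  by apply/measurable_EFinP; exact: measurable_int im.
have [i1 i2] := @Rintegral_dirac _ _ R (k0 : borel K) _ ms.
by rewrite (muE _ i1).2 i2.
Qed.

Lemma dual_functionE h Lam : weighted_functions sw h -> nonneg_charge Lam ->
  (dual_feasible Q delta r z h Lam ->
   dual_function Q delta r z nu y (fun s => - h s) Lam =
     (dual_objective nu y h Lam)%:E) /\
  (~ dual_feasible Q delta r z h Lam ->
   dual_function Q delta r z nu y (fun s => - h s) Lam = +oo%E).
Proof.
move=> wh Lam0; split.
  move=> [_ _ feas]; apply/eqP; rewrite eq_le; apply/andP; split.
    apply: ge_ereal_sup => _ [mu [wmu mu0] <-].
    have [im ->] := formula mu0 wmu wh Lam0.
    rewrite lee_fin gerDr -oppr_ge0 -RintegralN//.
    by apply: Rintegral_ge0 => k _; rewrite oppr_ge0; exact: feas.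
  have [mu [wmu mu0]] := lagrangian_dirac (@point K) (lexx 0) wh Lam0.
  rewrite mul0r add0r => <-; apply: ereal_sup_ubound; exists mu => //.
move=> nfeas; have [k0 k0P] : exists k, 0 < slack Q delta r z h Lam k.
  apply: contrapT => /forallNP nex; apply: nfeas; split => // k.
  by rewrite leNgt; apply/negP; exact: nex.
(* The mass placed at [k0] is chosen so that the Lagrangian reaches the arbitrary bound [B]. *)
apply/eqyP => B B0; pose D := dual_objective nu y h Lam.
have [|mu [wmu mu0 lmu]] := @lagrangian_dirac h Lam
  (Num.max 0 ((B - D) / slack Q delta r z h Lam k0)) k0 _ wh Lam0.
  by rewrite le_max lexx.
apply: (@le_trans _ _ (lagrangian Q delta r z nu y mu (fun s => - h s) Lam)%:E).
  rewrite lmu lee_fin -lerBlDr -ler_pdivrMr// le_max lexx orbT//.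
by apply: ereal_sup_ubound; exists mu.
Qed.

(** Pairs with a positive slack somewhere have dual function [+oo] and drop out of the infimum; on
    the others the dual function is the objective, after the sign change in [h]. *)
Lemma lagrangian_dual_valueE :
  lagrangian_dual_value Q delta r z nu ab y = dual_value Q delta r z nu ab y.
Proof.
have wN h : weighted_functions sw h -> weighted_functions sw (fun s => - h s).
  move=> [mh [C hC]]; split; first exact: measurableT_comp.
  by exists C => _ [s _ <-]; rewrite normrN; apply: hC; exists s.
apply/eqP; rewrite eq_le; apply/andP; split.
  apply: le_ereal_inf_tmp => _ [[h Lam] /= feas <-].
  have [wh Lam0 _] := feas.
  apply: ereal_inf_lbound; exists (fun s => - h s, Lam) => /=; first by split; [exact: wN|].
  exact: (dual_functionE wh Lam0).1 feas.
apply: le_ereal_inf_tmp => _ [[h Lam] /= [wh Lam0] <-].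
have hE : h = fun s => - (- h s) by apply/funext => s; rewrite opprK.
have [feasE nfeasE] := dual_functionE (wN _ wh) Lam0.
have [feas|nfeas] := pselect (dual_feasible Q delta r z (fun s => - h s) Lam).
  rewrite hE feasE//; apply: ereal_inf_lbound.
  by exists (fun s => - h s, Lam).
by rewrite hE nfeasE// leey.
Qed.

Lemma weak_duality mu h Lam : primal_feasible Q delta r z nu a b y mu ->
  dual_feasible Q delta r z h Lam ->
  pairing mu (r : borel K -> R) <= dual_objective nu y h Lam.
Proof.
move=> [wmu mu0 L0mu L1mu] [wh Lam0 feas].
have [im lE] := formula mu0 wmu wh Lam0.
apply: (@le_trans _ _ (lagrangian Q delta r z nu y mu (fun s => - h s) Lam)); last first.
  rewrite lE gerDr -oppr_ge0 -RintegralN//.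
  by apply: Rintegral_ge0 => k _; rewrite oppr_ge0; exact: feas.
(* The equality constraint makes [L0 mu - nu] the zero charge, that is, the difference of two zero
   measures. *)
rewrite /lagrangian (@pairing_difference _ _ _
  (cadd (L0 Q delta mu) (copp (charge_of_finite_measure nu))) mzero mzero).
- rewrite subrr addr0 lerDl; apply: pairing_ge0 => // eta.
  by rewrite subr_ge0; apply: L1mu; rewrite in_itv/= itv_val_bounds.
- by [].
- by [].
- move=> B mB; transitivity (L0 Q delta mu B - nu B)%E; first by [].
  by rewrite L0mu// subee ?fin_num_measure// /mzero sube0.
- apply/integrableP; split; last by rewrite integral_measure_zero.
  by apply/measurable_EFinP/measurableT_comp => //; case: wh.
- apply/integrableP; split; last by rewrite integral_measure_zero.
  by apply/measurable_EFinP/measurableT_comp => //; case: wh.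
Qed.

End dual_function.

(** * Topology and uniqueness of measures *)

Lemma hausdorff_separating (T : topologicalType) :
  (forall x y : T, x != y -> exists (T' : topologicalType) (g : T -> T'),
     [/\ hausdorff_space T', continuous g & g x != g y]) -> hausdorff_space T.
Proof.
move=> sep; rewrite open_hausdorff => x y /sep[T' [g [hT' cg gxy]]].
move: hT'; rewrite open_hausdorff => /(_ _ _ gxy)[[B C] /=].
rewrite !inE => -[Bx Cy] [oB oC BC0].
exists (g @^-1` B, g @^-1` C); rewrite /= ?inE//; split.
- by move/continuousP : cg; apply.
- by move/continuousP : cg; apply.
- by rewrite -preimage_setI BC0 preimage_set0.
Qed.

Lemma borel_space_hausdorff (R : realType) (S : topologicalType) :
  borel_space R S -> hausdorff_space S.
Proof.
move=> [X [f [_ _ inj_f of_ _]]]; apply: hausdorff_separating => x y xy.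
exists X, f; split.
- exact: metric_hausdorff.
- by apply/continuousP => V oV; apply/of_; exists V.
- by apply: contra_neq xy; exact: inj_f.
Qed.

Lemma admissible_hausdorff (S U : ptopologicalType) (A : S -> set U)
    (A0 : forall s, A s !=set0) :
  hausdorff_space S -> hausdorff_space U -> hausdorff_space (admissible A0).
Proof.
move=> hS hU; apply: hausdorff_separating => k k' kk'.
have cval : continuous (set_val : admissible A0 -> S * U) by exact: initial_continuous.
have [e1|ne1] := eqVneq (set_val k).1 (set_val k').1; last first.
  by exists S, (@state S U A A0); split => //; exact: continuous_state.
exists U, (fun k : admissible A0 => (set_val k).2); split => //.
  move=> x; apply: (@continuous_comp _ _ _ (set_val : admissible A0 -> S * U) snd).
    exact: cval.
  exact: cvg_snd.
apply: contra_neq kk' => e2; apply: val_inj; apply/eqP.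
by rewrite -pair_eqE/= /pair_eq; apply/andP; split; apply/eqP.
Qed.

Lemma compact_itv_hausdorff (R : realType) (a b : R) (ab : a <= b) :
  hausdorff_space (compact_itv ab).
Proof.
apply: hausdorff_separating => x y xy; exists R, set_val; split.
- exact: Rhausdorff.
- exact: itv_val_continuous.
- by apply: contra_neq xy; exact: val_inj.
Qed.

(** The clamp [c] is a continuous retraction of the line onto the interval; through it the subspace
    type becomes a continuous image of a compact segment. *)
Lemma compact_itv_compact (R : realType) (a b : R) (ab : a <= b) :
  compact [set: compact_itv ab].
Proof.
pose c (x : R) := Num.max a (Num.min b x).
have cP x : c x \in `[a, b]%classic.
  by rewrite inE/= in_itv/= /c le_max lexx/= ge_max ab/= ge_min lexx.
pose g (x : R) : compact_itv ab := exist _ (c x) (cP x).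
have cg : continuous g.
  apply: continuous_comp_initial => x.
  apply: (@continuous_max _ _ (fun=> a) (fun x => Num.min b x)) => //; first exact: cvg_cst.
  by apply: continuous_min; [exact: cvg_cst|exact: cvg_id].
rewrite (_ : [set: _] = g @` `[a, b]).
  apply: continuous_compact; last exact: segment_compact.
  exact: continuous_subspaceT.
apply/seteqP; split => // eta _; exists (set_val eta).
  by rewrite /= in_itv itv_val_bounds.
apply: val_inj; rewrite /= /c; have /andP[h1 h2] := itv_val_bounds eta.
by rewrite min_r// max_r.
Qed.

Section metric_distance.
Context (R : realType) (X : metricType R) (F : set X).
Hypothesis F0 : F !=set0.

Definition set_distance (x : X) : R := inf [set mdist x y | y in F].

Let distances x : has_inf [set mdist x y | y in F].
Proof.
split; first by have [y Fy] := F0; exists (mdist x y), y.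
by exists 0 => _ [y _ <-]; exact: mdist_ge0.
Qed.

Lemma set_distance_ge0 x : 0 <= set_distance x.
Proof.
by apply: lb_le_inf; [case: (distances x)|move=> _ [y _ <-]; exact: mdist_ge0].
Qed.

Lemma set_distance0 x : F x -> set_distance x = 0.
Proof.
move=> Fx; apply/eqP; rewrite eq_le set_distance_ge0 andbT.
by apply: ge_inf; [case: (distances x)|exists x => //; exact: mdistxx].
Qed.

Lemma set_distance_gt0 x : closed F -> ~ F x -> 0 < set_distance x.
Proof.
move=> cF Fx; have : nbhs x (~` F).
  by apply: open_nbhs_nbhs; split => //; exact: closed_openC.
move/nbhs_ballP => [e /= e0 xeF]; apply: (lt_le_trans e0).
apply: lb_le_inf; first by case: (distances x).
move=> _ [y Fy <-]; rewrite leNgt; apply/negP => xy.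
by apply: (xeF y) => //; rewrite ballEmdist.
Qed.

Lemma set_distance_continuous : continuous set_distance.
Proof.
have lip x y : set_distance x <= set_distance y + mdist x y.
  rewrite -lerBlDr; apply: lb_le_inf; first by case: (distances y).
  move=> _ [u Fu <-]; rewrite lerBlDr; apply: (@le_trans _ _ (mdist x u)).
    by apply: ge_inf; [case: (distances x)|exists u].
  by rewrite addrC; exact: metric_triangle.
move=> x; apply/cvgrPdist_lt => e e0; near=> y.
have xy : mdist x y < e.
  have : ball x e y by near: y; exact: nbhsx_ballx.
  by rewrite ballEmdist.
have h1 := lip x y; have h2 := lip y x; rewrite (metric_sym y x) in h2.
by rewrite ltr_norml; apply/andP; split; lra.
Unshelve. all: by end_near. Qed.

End metric_distance.

Section measure_unique.
Context (R : realType) (S : ptopologicalType) (bS : borel_space R S).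

Let bounded_continuous_agree (m m' : {finite_measure set (borel S) -> \bar R}) :=
  forall g : S -> R, continuous g -> bounded_fct g ->
    \int[m]_s g s = \int[m']_s g s.

(** [V] is an open set of the ambient metric space whose trace is [G]. The functions [g n],
    truncated multiples of the distance to the complement of [V], are bounded and continuous and
    increase to the indicator of [G]. *)
Let open_le (m m' : {finite_measure set (borel S) -> \bar R}) (G : set S) :
  bounded_continuous_agree m m' -> open G -> (m G <= m' G)%E.
Proof.
move=> mm' oG; have [X [f [_ _ _ of_ _]]] := bS.
have cf : continuous f by apply/continuousP => V oV; apply/of_; exists V.
have mG : measurable (G : set (borel S)) by exact: measurable_open.
have [V oV GV] := (of_ G).1 oG.
have bint (m0 : {finite_measure set (borel S) -> \bar R}) (g : S -> R) : bounded_borel g ->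
    (\int[m0]_s (g s)%:E = (\int[m0]_s g s)%:E)%E.
  move=> bg; rewrite /Rintegral fineK//.
  exact: (integrable_fin_num measurableT (bounded_borel_integrable m0 bg)).
(* The distance requires a nonempty complement. If [V] is the whole space then so is [G], and the
   constant 1 compares the masses. *)
have [V0|/set0P V0] := eqVneq (~` V) set0.
  have -> : G = setT by rewrite GV -(setCK V) V0 setC0.
  have /= := mm' (cst 1) (fun x => cvg_cst _) (ex_intro _ 1 _).
  rewrite !Rintegral_cst// !mul1r => e.
  rewrite -[leLHS]fineK ?fin_num_measure// e ?fineK ?fin_num_measure//.
  by move=> s; rewrite normr1.
pose D s := set_distance (~` V) (f s).
have D0 s : 0 <= D s by exact: set_distance_ge0.
have cD : continuous D.
  move=> s; apply: (@continuous_comp S X R f (set_distance (~` V))); first exact: cf.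
  exact: set_distance_continuous.
pose g n s : R := Num.min 1 (n%:R * D s).
have g01 n s : 0 <= g n s <= 1.
  by rewrite /g ge_min lexx/= le_min ler01/= mulr_ge0.
have cg n : continuous (g n).
  move=> s; apply: (@continuous_min _ _ (fun=> 1) (fun s => n%:R * D s)).
    exact: cvg_cst.
  by apply: cvgMl_tmp; exact: cD.
have bg n : bounded_fct (g n).
  by exists 1 => s; have /andP[h1 h2] := g01 n s; rewrite ger0_norm.
have bbg n : bounded_borel (g n) by exact: continuous_bounded_borel.
have gG n s : g n s <= \1_G s.
  rewrite indicE; have [_|/negP] := boolP (s \in G); first by case/andP: (g01 n s).
  rewrite inE GV => Vs; rewrite /g /D set_distance0// mulr0.
  by rewrite ge_min lexx orbT.
have : (\int[m]_s (g n s)%:E @[n --> \oo] --> \int[m]_s (\1_G s)%:E)%E.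
  apply: (@dominated_cvg _ _ _ m setT measurableT (fun n => EFin \o g n)
    (EFin \o \1_G) (EFin \o cst 1)) => //.
  - by move=> n; apply/measurable_EFinP; case: (bbg n).
  - move=> s _; apply: cvg_near_cst; rewrite /= indicE.
    have [/set_mem Gs|/negP] := boolP (s \in G).
      have Ds : 0 < D s.
        apply: set_distance_gt0 => //; first exact: open_closedC.
        by rewrite GV in Gs => /=; apply.
      near=> n; rewrite /g min_l//.
      rewrite -ler_pdivrMr//; near: n; exact: nbhs_infty_ger.
    by rewrite inE GV => Vs; near=> n; rewrite /g /D set_distance0// mulr0 min_r.
  - apply: (@finite_measure_integrable_cst _ _ _ m).
    exact: measurableT.
  - by move=> n s _ /=; rewrite lee_fin ger0_norm; case/andP: (g01 n s).
rewrite integral_indic// setIT => /cvg_lim => <-//.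
apply: lime_le.
  apply: ereal_nondecreasing_is_cvgn => i j ij; apply: ge0_le_integral => //.
  - by move=> s _; rewrite lee_fin; case/andP: (g01 i s).
  - by apply/measurable_EFinP; case: (bbg i).
  - by apply/measurable_EFinP; case: (bbg j).
  - move=> s _; rewrite lee_fin /g le_min !ge_min lexx/=; apply/orP; right.
    by rewrite ler_wpM2r// ler_nat.
apply: nearW => n; rewrite bint// mm'// -bint//.
rewrite -[X in (_ <= m' X)%E](setIT G) -integral_indic//; apply: ge0_le_integral => //.
- by move=> s _; rewrite lee_fin; case/andP: (g01 n s).
- by apply/measurable_EFinP; case: (bbg n).
- by apply/measurable_EFinP.
- by move=> s _; rewrite lee_fin.
Unshelve. all: by end_near. Qed.

(** Open sets are stable under intersection and generate the Borel sets; [open_le] in both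
    directions gives equality on them. *)
Lemma borel_space_measure_unique (m m' : {finite_measure set (borel S) -> \bar R}) :
  (forall g : S -> R, continuous g -> bounded_fct g ->
    \int[m]_s g s = \int[m']_s g s) ->
  forall B, measurable B -> m B = m' B.
Proof.
move=> mm' B mB; apply: (@measure_unique _ R (borel S) (@open S) (fun=> setT) _ _ _ _ m m') => //.
- exact: openI.
- by move=> i; exact: openT.
- by rewrite bigcup_const//; exists 0%N.
- move=> G oG; apply/eqP; rewrite eq_le !open_le// => g cg bg.
  by rewrite mm'.
- by move=> i; rewrite -ge0_fin_numE ?fin_num_measure.
Qed.

End measure_unique.

(** * Absence of a duality gap *)

Section finitely_supported.
Context (R : realType) (T : Type).
Implicit Types (mu : seq (R * T)) (f g : T -> R).

Definition finite_expectation mu f : R := \sum_(p <- mu) p.1 * f p.2.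

Local Notation E := finite_expectation.

(** Positivity is asked of the expectation, not of the individual weights: a point may occur several
    times in the list, and only the functional is used. *)
Definition finite_probability mu : Prop :=
  (forall f, (forall x, 0 <= f x) -> 0 <= E mu f) /\ E mu (cst 1) = 1.

Lemma finite_expectationD mu f g : E mu (fun x => f x + g x) = E mu f + E mu g.
Proof. by rewrite /E -big_split; apply: eq_bigr => p _; rewrite mulrDr. Qed.

Lemma finite_expectationZ mu c f : E mu (fun x => c * f x) = c * E mu f.
Proof. by rewrite /E mulr_sumr; apply: eq_bigr => p _; rewrite mulrCA. Qed.

(** Concatenating the rescaled lists makes every expectation exactly affine, with no need to merge
    repeated points. *)
Definition finite_mix (t : R) mu mu' : seq (R * T) :=
  [seq (t * p.1, p.2) | p <- mu] ++ [seq ((1 - t) * p.1, p.2) | p <- mu'].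

Lemma finite_expectation_mix t mu mu' f :
  E (finite_mix t mu mu') f = t * E mu f + (1 - t) * E mu' f.
Proof.
rewrite /E big_cat/= !big_map !mulr_sumr/=.
by congr (_ + _); apply: eq_bigr => p _; rewrite mulrA.
Qed.

Lemma finite_probability_mix : mix_closed finite_mix finite_probability.
Proof.
move=> t mu mu' /andP[t0 t1] [mu0 mu1] [mu'0 mu'1]; split => [f f0|].
  rewrite finite_expectation_mix addr_ge0// mulr_ge0// ?subr_ge0//.
    exact: mu0.
  exact: mu'0.
by rewrite finite_expectation_mix mu1 mu'1; ring.
Qed.

Lemma finite_probability_dirac x : finite_probability [:: (1, x)].
Proof.
split => [f f0|]; rewrite /E big_seq1 mul1r//.
Qed.

(* Each [g] is affine on finitely supported probabilities, so [convex_alternative]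
   gives the sets [0 <= E mu g] the finite intersection property. *)
Lemma convex_family_ultrafilter (F : set (T -> R)) :
  F !=set0 ->
  (forall t g h, 0 <= t <= 1 -> F g -> F h -> F (fun x => t * g x + (1 - t) * h x)) ->
  (forall g, F g -> exists x, 0 < g x) ->
  exists G : set_system (seq (R * T)), UltraFilter G /\
    forall g, F g -> G [set mu | finite_probability mu /\ 0 <= E mu g].
Proof.
move=> [g0 Fg0] Fconv Fpos.
pose B (g : T -> R) := [set mu | finite_probability mu /\ 0 <= E mu g].
have fin : finI F B.
  move=> D DF; apply: contrapT => /set0P/negP; rewrite negbK => /eqP B0.
  pose FE := [set (fun mu => E mu g) | g in F].
  have [|_ [g Fg <-]|t _ _ t01 [g Fg <-] [h Fh <-]|||x Px|_ [h Fh <-] hneg] :=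
    @convex_alternative R _ finite_mix FE _ _ _ (size D).+1
      (fun i mu => E mu (nth g0 (g0 :: D) i)) finite_probability.
  - by exists (fun mu => E mu g0), g0.
  - by move=> t mu mu' _; exact: finite_expectation_mix.
  - exists (fun x => t * g x + (1 - t) * h x); first exact: Fconv.
    by apply/funext => mu; rewrite finite_expectationD !finite_expectationZ.
  - exact: finite_probability_mix.
  - move=> i; rewrite ltnS => iD; exists (nth g0 (g0 :: D) i) => //.
    case: i iD => [|i]//= iD; apply/set_mem/DF; exact: mem_nth.
  - apply: contrapT => nex.
    suff : (\bigcap_(i in [set i | i \in D]) B i) x by rewrite B0.
    move=> g /= gD; split => //; rewrite leNgt; apply/negP => Eg.
    apply: nex; exists (index g D).+1; first by rewrite ltnS index_mem.
    by rewrite /= nth_index.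
  have [x hx] := Fpos _ Fh.
  have := hneg _ (finite_probability_dirac x).
  by rewrite /E big_seq1 mul1r leNgt hx.
have [G [UG sG]] := ultraFilterLemma (finI_filter fin).
exists G; split => // g Fg; apply: sG.
by exists (B g) => //; exact: finI_from1.
Qed.

End finitely_supported.

Lemma pairing_combination d (T : measurableType d) (R : realType)
    (mu1 mu2 : {charge set T -> \bar R}) (s t : R) : 0 <= s -> 0 <= t ->
  nonneg_charge mu1 -> nonneg_charge mu2 ->
  nonneg_charge (cadd (cscale s mu1) (cscale t mu2)) /\
  forall g : T -> R, (measure_of mu1).-integrable setT (EFin \o g) ->
    (measure_of mu2).-integrable setT (EFin \o g) ->
    pairing (cadd (cscale s mu1) (cscale t mu2)) g =
      s * pairing mu1 g + t * pairing mu2 g.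
Proof.
move=> s0 t0 mu10 mu20; set mu := cadd _ _.
have mu0 : nonneg_charge mu.
  move=> B mB; change (0 <= s%:E * mu1 B + t%:E * mu2 B)%E.
  by rewrite adde_ge0// mule_ge0 ?lee_fin// ?mu10 ?mu20.
split => // g g1 g2.
have [i1 e1] := Rintegral_mscale (NngNum s0) g1.
have [i2 e2] := Rintegral_mscale (NngNum t0) g2.
pose m : {measure set T -> \bar R} :=
  measure_add (mscale (NngNum s0) (measure_of mu1)) (mscale (NngNum t0) (measure_of mu2)).
have mE B : measurable B -> m B = measure_of mu B.
  move=> mB; have -> : measure_of mu B = (s%:E * mu1 B + t%:E * mu2 B)%E.
    exact: measure_ofE.
  rewrite -(measure_ofE mu10 mB) -(measure_ofE mu20 mB).
  exact: (measure_addE (mscale (NngNum s0) (measure_of mu1))).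
have [/integrableP[mg h1] /integrableP[_ h2]] := (i1, i2).
have im : m.-integrable setT (EFin \o g).
  apply/integrableP; split => //.
  rewrite ge0_integral_measure_add//; last exact: measurableT_comp.
  by rewrite lte_add_pinfty.
rewrite pairing_nonneg//; last exact: eq_measure_integrable mE im.
rewrite -(eq_measure_Rintegral g mE) Rintegral_measure_add// e1 e2/=.
by rewrite !pairing_nonneg.
Qed.

Lemma finite_expectation_le (R : realType) (T : Type) (mu : seq (R * T)) (f g : T -> R) :
  finite_probability mu -> (forall x, f x <= g x) ->
  finite_expectation mu f <= finite_expectation mu g.
Proof.
move=> [mu0 _] fg; rewrite -subr_ge0 -mulN1r -finite_expectationZ -finite_expectationD.
by apply: mu0 => x; rewrite mulN1r subr_ge0.
Qed.

Lemma finite_expectation_cst (R : realType) (T : Type) (mu : seq (R * T)) c :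
  finite_probability mu -> finite_expectation mu (fun=> c) = c.
Proof.
move=> [_ mu1]; rewrite -[RHS]mulr1 -mu1 -finite_expectationZ.
by congr finite_expectation; apply/funext => x; rewrite mulr1.
Qed.

Lemma finite_expectation_affine (R : realType) (T : Type) (mu : seq (R * T))
    (f1 f2 f3 : T -> R) (t c : R) : finite_probability mu ->
  finite_expectation mu (fun x => f1 x - f2 x + t * f3 x + c) =
  finite_expectation mu f1 - finite_expectation mu f2 +
    t * finite_expectation mu f3 + c.
Proof.
move=> fmu; have -> : - finite_expectation mu f2 = finite_expectation mu (fun x => - f2 x).
  rewrite -mulN1r -finite_expectationZ; congr finite_expectation.
  by apply/funext => x; rewrite mulN1r.
by rewrite !finite_expectationD finite_expectationZ finite_expectation_cst.
Qed.

(** This lemma and the next one isolate single constraints: the multipliers can be scaled by [t]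
    while the bound, which comes from [q], stays fixed. *)
Lemma linear_bounded_above0 (R : realType) (x c : R) : (forall t, t * x <= c) -> x = 0.
Proof.
move=> h; apply/eqP; apply: contrapT => /negP x0.
have := h ((`|c| + 1) / x); rewrite divfK//; have := ler_norm c; lra.
Qed.

Lemma linear_bounded_below_ge0 (R : realType) (x c : R) :
  (forall t, 0 <= t -> c <= t * x) -> 0 <= x.
Proof.
move=> h; rewrite leNgt; apply/negP => x0.
have h1 := ler_norm (- c); rewrite normrN in h1; have h2 := normr_ge0 c.
have t0 : 0 <= (`|c| + 1) / - x by rewrite divr_ge0 ?oppr_ge0 ?(ltW x0)// addr_ge0.
have := h _ t0; rewrite invrN mulrN mulNr divfK ?lt_eqF//; lra.
Qed.

Lemma continuousBZ (R : realType) (T : topologicalType) (f g : T -> R) c :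
  continuous f -> continuous g -> continuous (fun x => f x - c * g x).
Proof. by move=> cf cg x; apply: cvgB; [exact: cf|apply: cvgMl_tmp; exact: cg]. Qed.

Section primal_existence.
Context (R : realType) (S U : ptopologicalType) (A : S -> set U).
Variables (A0 : forall s, A s !=set0) (Q : R.-pker (borel (admissible A0)) ~> (borel S)).
Variables (delta : R) (r z : admissible A0 -> R) (nu : probability (borel S) R).
Variables (a b : R) (ab : a <= b) (y : R -> R).
Local Notation K := (admissible A0).
Local Notation I := (compact_itv ab).
Local Notation sw := (state_weight r : borel S -> R).
Local Notation st := (@state S U A A0).
Implicit Types (mu : {charge set (borel K) -> \bar R}) (h : S -> R).
Implicit Types (Lam : {charge set (borel I) -> \bar R}).
Hypothesis bS : borel_space R S.
Hypothesis hK : hausdorff_space K.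
Hypothesis delta01 : 0 < delta < 1.
Hypothesis r_le0 : forall k, r k <= 0.
Hypothesis r_compact : forall eps : R, 0 <= eps -> compact [set k | - eps <= r k].
Hypothesis mr : measurable_fun [set: borel K] r.
Hypothesis mz : measurable_fun [set: borel K] z.
Hypothesis bz : bounded_fct z.
Hypothesis uz : upper_semicontinuous z.
Hypothesis feller : forall h : S -> R, continuous h -> bounded_fct h ->
  continuous (fun k : K => \int[Q k]_s h s) /\
  bounded_fct (fun k : K => \int[Q k]_s h s).
Hypothesis yb : bounded_borel (fun eta : I => y (set_val eta)).

Let delta0 : 0 < delta. Proof. by case/andP: delta01. Qed.
Let delta1 : 0 < 1 - delta. Proof. by rewrite subr_gt0; case/andP: delta01. Qed.

Let Cb h := continuous h /\ bounded_fct h.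

Let Cb_borel h : Cb h -> bounded_borel h.
Proof. by move=> [ch bh]; exact: continuous_bounded_borel. Qed.

Let Cb_integrable (m : {measure set (borel S) -> \bar R}) h : m setT = 1%E -> Cb h ->
  m.-integrable setT (EFin \o h).
Proof.
move=> m1 /Cb_borel[mh [B hB]].
apply: (@le_integrable _ _ _ m setT _ _ (cst B%:E)) => //.
- exact/measurable_EFinP.
- by move=> s _ /=; rewrite lee_fin (le_trans (hB s))// ler_norm.
- apply/integrableP; split; first exact: measurable_cst.
  by rewrite integral_cst// m1 mule1 ltry.
Qed.

Let Q1 k : Q k setT = 1%E. Proof. exact: prob_kernel. Qed.

Let nu1 : nu setT = 1%E. Proof. exact: probability_setT. Qed.

Let Cb_combination h h' s t : Cb h -> Cb h' -> Cb (fun x => s * h x + t * h' x).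
Proof.
move=> [ch [B hB]] [ch' [B' hB']]; split.
  by move=> x; apply: cvgD; apply: cvgMl_tmp; [exact: ch|exact: ch'].
exists (`|s| * B + `|t| * B') => x; rewrite (le_trans (ler_normD _ _))// !normrM.
by rewrite lerD// ler_wpM2l.
Qed.

Let Rint_combination (m : {measure set (borel S) -> \bar R}) h h' s t :
  m setT = 1%E -> Cb h -> Cb h' ->
  \int[m]_x (s * h x + t * h' x) = s * \int[m]_x h x + t * \int[m]_x h' x.
Proof.
move=> m1 Ch Ch'; have i1 := Cb_integrable m1 Ch; have i2 := Cb_integrable m1 Ch'.
rewrite RintegralD//; last 2 first.
- exact: (integrableZl measurableT s i1).
- exact: (integrableZl measurableT t i2).
by rewrite !RintegralZl.
Qed.

Let L0_adj_combination h h' s t k : Cb h -> Cb h' ->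
  L0_adj Q delta (fun x => s * h x + t * h' x) k =
  s * L0_adj Q delta h k + t * L0_adj Q delta h' k.
Proof.
by move=> Ch Ch'; rewrite /L0_adj Rint_combination//; ring.
Qed.

Let Cb_cst c : Cb (fun=> c).
Proof. by split; [move=> x; exact: cvg_cst|exists `|c|]. Qed.

Let L0_adj_cst c k : L0_adj Q delta (fun=> c) k = (1 - delta) * c.
Proof.
by rewrite /L0_adj Rintegral_cst// Q1/=; ring.
Qed.

Let Cb_weighted h : Cb h -> weighted_functions sw h.
Proof.
move=> [ch [B hB]]; split; first exact: continuous_borel_measurable.
exists B => _ [s _ <-]; rewrite ler_pdivrMr; last first.
  by rewrite (lt_le_trans _ (state_weight_ge1 r_le0 s)).
have B0 : 0 <= B by rewrite (le_trans _ (hB point)).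
rewrite (le_trans (hB s))// ler_peMr//; exact: state_weight_ge1.
Qed.

Let neg_part_bounded_borel k :
  bounded_borel (fun eta : I => neg_part (z k - set_val eta)).
Proof.
split.
  apply: neg_part_measurable; apply: measurable_funB; first exact: measurable_cst.
  exact: itv_val_measurable.
have [B zB] := bz; exists (B + (`|a| + `|b|)) => eta.
rewrite (le_trans (ler_norm_neg_part _))// (le_trans (ler_normB _ _))//.
by rewrite lerD//; exact: itv_val_norm.
Qed.

(** Adding a constant [c] to [h] raises the objective by [c] and [L0_adj] by [(1 - delta) * c], so
    this quantity does not change. It is the slack that [h] has after the shift that brings the
    objective to [q]. *)
Definition relaxed_slack q h Lam (k : K) : R :=
  slack Q delta r z h Lam k + (1 - delta) * (dual_objective nu y h Lam - q).

Lemma relaxed_slack_feasible q h Lam : continuous h -> bounded_fct h ->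
  nonneg_charge Lam -> (forall k, relaxed_slack q h Lam k <= 0) ->
  exists h', dual_feasible Q delta r z h' Lam /\ dual_objective nu y h' Lam = q.
Proof.
move=> ch bh Lam0 neg; pose c := q - dual_objective nu y h Lam.
have Ch : Cb h by []; have Cc := Cb_cst c.
have hE : (fun s => h s + c) = (fun s => 1 * h s + 1 * (fun=> c) s).
  by apply/funext => s; rewrite !mul1r.
exists (fun s => h s + c); rewrite hE; split.
  split => // [|k]; first by apply: Cb_weighted; exact: Cb_combination.
  rewrite L0_adj_combination// L0_adj_cst !mul1r; apply: le_trans (neg k).
  rewrite /relaxed_slack /slack /c; lra.
rewrite /dual_objective Rint_combination// !mul1r Rintegral_cst//.
rewrite [fine _](_ : _ = 1); last exact: (congr1 fine nu1).
rewrite mulr1 /c /dual_objective; lra.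
Qed.

Let relaxed_family q : set (K -> R) := [set g | exists h Lam,
  [/\ Cb h, nonneg_charge Lam & g = relaxed_slack q h Lam]].

Let relaxed_family_convex q t g g' : 0 <= t <= 1 ->
  relaxed_family q g -> relaxed_family q g' ->
  relaxed_family q (fun x => t * g x + (1 - t) * g' x).
Proof.
move=> /andP[t0 t1] [h [Lam [Ch Lam0 ->]]] [h' [Lam' [Ch' Lam'0 ->]]].
have t1' : 0 <= 1 - t by rewrite subr_ge0.
have [LL0 LLE] := pairing_combination t0 t1' Lam0 Lam'0.
exists (fun s => t * h s + (1 - t) * h' s), (cadd (cscale t Lam) (cscale (1 - t) Lam')).
split => //; first exact: Cb_combination.
apply/funext => k; rewrite /relaxed_slack /slack /dual_objective.
rewrite L0_adj_combination// Rint_combination// /L1_adj.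
have nb := neg_part_bounded_borel k.
rewrite LLE; [|exact: bounded_borel_integrable|exact: bounded_borel_integrable].
rewrite LLE; [|exact: bounded_borel_integrable|exact: bounded_borel_integrable].
ring.
Qed.

Let point_mass (t : R) (eta : I) : {charge set (borel I) -> \bar R} :=
  cscale t (charge_of_finite_measure (\d_(eta : borel I))).

Let point_massE t eta : 0 <= t -> nonneg_charge (point_mass t eta) /\
  forall g : I -> R, bounded_borel g -> pairing (point_mass t eta) g = t * g eta.
Proof.
move=> t0; have [Lam0 LamE] := Rintegral_cscale (\d_(eta : borel I)) t0.
split => // g [mg _]; have [i1 i2] := Rintegral_dirac (eta : borel I) mg.
have [i3 i4] := LamE _ i1; rewrite pairing_nonneg// i4; congr (_ * _).
exact: i2.
Qed.

Local Notation E := finite_expectation.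
Let np (eta : I) (k : K) : R := neg_part (z k - set_val eta).

Lemma primal_existence q :
  (forall h Lam, continuous h -> bounded_fct h -> nonneg_charge Lam ->
    exists k, 0 < relaxed_slack q h Lam k) ->
  exists2 mu, primal_feasible Q delta r z nu a b y mu &
    q <= pairing mu (r : borel K -> R).
Proof.
move=> pos.
have [|g [h [Lam [[ch bh] Lam0 ->]]]|G [UG GF]] :=
  @convex_family_ultrafilter R K (relaxed_family q) _ (@relaxed_family_convex q).
- have [Lam0 _] := @point_massE 0 point (lexx 0).
  by exists (relaxed_slack q (fun=> 0) (point_mass 0 point)), (fun=> 0), (point_mass 0 point).
- exact: pos.
pose fp : set (seq (R * K)) := @finite_probability R K.
(* Among the multipliers only multiples of point masses are kept: they test the constraint at one
   [eta] at a time, and [L1_adj] becomes [t] times [np eta]. *)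
have key h t eta : Cb h -> 0 <= t -> G [set p | fp p /\
    0 <= E p r - E p (L0_adj Q delta h) + t * E p (np eta) +
      (1 - delta) * (\int[nu]_s h s - t * y (set_val eta) - q)].
  move=> Ch t0; have [Lam0 LamE] := point_massE eta t0.
  have := GF (relaxed_slack q h (point_mass t eta)) _.
  move=> /(_ (ex_intro _ h (ex_intro _ _ (And3 Ch Lam0 erefl)))).
  apply: filterS => p [fpp Ep]; split => //; apply: (le_trans Ep).
  rewrite -finite_expectation_affine//.
  apply: finite_expectation_le => // k.
  by rewrite /relaxed_slack /slack /dual_objective LamE// /L1_adj LamE.
have r_np (p : seq (R * K)) : fp p -> E p r <= 0.
  move=> fpp; rewrite -(finite_expectation_cst 0 fpp).
  exact: finite_expectation_le.
(* [ultralimit_measure] wants positivity and mass at most 1 at every index, while a list need not be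
   a probability. Off the probabilities, evaluation at [point] is a harmless default, because [G]
   contains sets of probabilities only. *)
pose N (p : seq (R * K)) (f : K -> R) : R := if `[< fp p >] then E p f else f point.
have NE (p : seq (R * K)) f : fp p -> N p f = E p f by rewrite /N => /asboolP ->.
have N_ge0 p f : bounded_borel f -> (forall x, 0 <= f x) -> 0 <= N p f.
  by move=> _ f0; rewrite /N; case: asboolP => // -[mu0 _]; exact: mu0.
have ND p f g : bounded_borel f -> bounded_borel g ->
    N p (fun x => f x + g x) = N p f + N p g.
  by move=> _ _; rewrite /N; case: asboolP => // _; exact: finite_expectationD.
have NZ p c f : bounded_borel f -> N p (fun x => c * f x) = c * N p f.
  by move=> _; rewrite /N; case: asboolP => // _; exact: finite_expectationZ.
have N1 p : N p (cst 1) = 1 by rewrite /N; case: asboolP => // -[].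
(* With both multipliers zero the relaxed slack is [r] minus [(1 - delta) * q]. *)
have Gr : G [set p | fp p /\ (1 - delta) * q <= E p r].
  have := key _ 0 point (Cb_cst 0) (lexx 0).
  apply: filterS => p [fpp H]; split => //; move: H; rewrite mul0r addr0.
  have -> : L0_adj Q delta (fun=> 0) = fun=> 0.
    by apply/funext => k; rewrite L0_adj_cst mulr0.
  rewrite finite_expectation_cst// Rintegral_cst// !mul0r; lra.
have Ntight e : 0 < e -> exists2 C : set K, compact C & G [set p | N p \1_(~` C) <= e].
  (* Markov's inequality: off the set where [- c <= r], the indicator is at most [- r / c], and the
     expectation of [- r] is at most the absolute value of [(1 - delta) * q], hence at most [c * e].
     The added 1 makes [c] positive. *)
  move=> e0; pose c := 1 + `|(1 - delta) * q| / e.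
  have c0 : 0 < c by rewrite ltr_pwDl// divr_ge0// ltW.
  exists [set k | - c <= r k]; first by apply: r_compact; exact: ltW.
  apply: filterS Gr => p [fpp Er] /=; rewrite NE//.
  apply: (@le_trans _ _ (E p (fun k => - c^-1 * r k))).
    apply: finite_expectation_le => // k; rewrite indicE mulNr -mulrN.
    have [kC|_] := boolP (k \in _); last by rewrite mulr_ge0 ?oppr_ge0// invr_ge0 ltW.
    have : - c > r k by move: kC; rewrite inE /= => /negP; rewrite -ltNge.
    rewrite ltrNr => /ltW h; rewrite mulrC ler_pdivlMr// mul1r//.
  rewrite finite_expectationZ mulNr -mulrN mulrC ler_pdivrMr//.
  apply: (@le_trans _ _ (`|(1 - delta) * q|)).
    apply: (@le_trans _ _ (- ((1 - delta) * q))); first by rewrite lerN2.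
    by rewrite -normrN ler_norm.
  rewrite /c mulrDr mulr1 mulrCA divff ?gt_eqF// mulr1; lra.
have [m [m1 [mlsc mC]]] := @ultralimit_measure R _ G UG K N 1 hK N_ge0 ND NZ
  (fun p => eq_ind_r (fun x => x <= 1) (lexx 1) (N1 p)) Ntight.
have N1le p : N p (cst 1) <= 1 by rewrite N1.
have bN f : bounded_borel f -> bounded_fct (N ^~ f).
  exact: (bounded_functional N_ge0 ND NZ N1le).
pose u f := ulim G (N ^~ f).
have bL0 h : Cb h -> continuous (L0_adj Q delta h) /\ bounded_fct (L0_adj Q delta h).
  move=> [ch bh]; have [cQ bQ] := feller ch bh; split.
    apply: (continuousBZ (f := fun k : K => h (st k))) cQ => k.
    apply: (@continuous_comp K S R st h); last exact: ch.
    exact: continuous_state.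
  case: bh => B hB; case: bQ => C QC; exists (B + `|delta| * C) => k.
  by rewrite (le_trans (ler_normB _ _))// lerD// normrM ler_wpM2l.
(* The expectation of [r] is nonpositive, so [key] for [t * h] bounds [t] times the defect of this
   equation by a constant, for [t] of either sign; the defect is therefore 0. *)
have mL0 h : Cb h -> \int[m]_k L0_adj Q delta h k = (1 - delta) * \int[nu]_s h s.
  move=> Ch; have [cL bL] := bL0 _ Ch; rewrite mC// -/(u _).
  have bbL := continuous_bounded_borel cL bL.
  apply/eqP; rewrite -subr_eq0; apply/eqP.
  apply: (@linear_bounded_above0 _ _ (- ((1 - delta) * q))) => t.
  rewrite mulrBr -ulimZ; last exact: bN.
  rewrite lerBlDr; apply: ulim_le.
    by have [B HB] := bN _ bbL; exists (`|t| * B) => p; rewrite normrM ler_wpM2l.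
  have thE : (fun s => t * h s) = (fun s => t * h s + 0 * h s).
    by apply/funext => s; rewrite mul0r addr0.
  have Cth : Cb (fun s => t * h s) by rewrite thE; exact: Cb_combination.
  have := key (fun s => t * h s) 0 point Cth (lexx 0).
  apply: filterS => p [fpp] /=; rewrite NE//.
  have -> : L0_adj Q delta (fun s => t * h s) = (fun k => t * L0_adj Q delta h k).
    by apply/funext => k; rewrite thE L0_adj_combination// mul0r addr0.
  rewrite finite_expectationZ RintegralZl//; last exact: Cb_integrable.
  have := r_np _ fpp; rewrite !mul0r.
  set x1 := E p r; set x2 := E p _; set x3 := \int[nu]_x h x => h1 h2.
  have e : t * ((1 - delta) * x3) = (1 - delta) * (t * x3) by ring.
  by lra.
have bnp eta : bounded_borel (np eta).
  split; first by apply: neg_part_measurable; apply: measurable_funB => //; exact: measurable_cst.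
  have [B zB] := bz; exists (B + (`|a| + `|b|)) => k.
  rewrite (le_trans (ler_norm_neg_part _))// (le_trans (ler_normB _ _))//.
  by rewrite lerD//; exact: itv_val_norm.
(* Scaling the point mass by all [t >= 0] gives the bound for the ultralimit of [np eta];
   semicontinuity of [- np eta] then passes from the ultralimit to the integral. *)
have mnp eta : (1 - delta) * y (set_val eta) <= \int[m]_k np eta k.
  apply: (@le_trans _ _ (u (np eta))).
    rewrite -subr_ge0; apply: (@linear_bounded_below_ge0 _ _ ((1 - delta) * q)) => t t0.
    rewrite mulrBr -ulimZ; last exact: bN.
    rewrite lerBrDr; apply: ulim_ge.
      by have [B HB] := bN _ (bnp eta); exists (`|t| * B) => p; rewrite normrM ler_wpM2l.
    have := key _ t eta (Cb_cst 0) t0.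
    apply: filterS => p [fpp] /=; rewrite NE//.
    have -> : L0_adj Q delta (fun=> 0) = fun=> 0.
      by apply/funext => k; rewrite L0_adj_cst mulr0.
    rewrite finite_expectation_cst// Rintegral_cst// mul0r.
    have := r_np _ fpp; set x1 := E p r; set x2 := E p _; set x3 := y _ => h1 h2.
    have e : t * ((1 - delta) * x3) = (1 - delta) * (t * x3) by ring.
  by lra.
  have bN1 : bounded_borel (fun k => -1 * np eta k) by exact: bounded_borelZ.
  have inp := bounded_borel_integrable m (bnp eta).
  have np0 k : 0 <= -1 * np eta k.
    by rewrite mulN1r oppr_ge0 /np /neg_part ge_min lexx orbT.
  have npo c : open [set k | c < -1 * np eta k].
    have [c0|c0] := ltP c 0.
      rewrite (_ : mkset _ = setT); first exact: openT.
      by apply/seteqP; split => // k _ /=; exact: (lt_le_trans c0).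
    (* Above a level [c >= 0] the truncation in [neg_part] is invisible, so this is a superlevel set
       of [- z]. *)
    have -> : [set k | c < -1 * np eta k] = [set k | ((c - set_val eta)%:E < (- z k)%:E)%E].
      apply/seteqP; split => k /=; rewrite lte_fin mulN1r /np /neg_part.
        by case: (leP (z k - set_val eta) 0); lra.
      by case: (leP (z k - set_val eta) 0); lra.
    by move/lower_semicontinuousP : uz; exact.
  have := mlsc _ np0 bN1.2 npo.
  have -> : (\int[m]_x (-1 * np eta x)%:E = (\int[m]_x (-1 * np eta x))%:E)%E.
    rewrite /Rintegral fineK//; apply: (integrable_fin_num measurableT).
    exact: (bounded_borel_integrable m bN1).
  rewrite lee_fin RintegralZl//.
  have -> : N ^~ (fun k => -1 * np eta k) = fun p => -1 * N p (np eta).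
    by apply/funext => p; exact: NZ.
  by rewrite ulimZ ?mulN1r ?lerN2//; exact: bN.
(* [- r] may be unbounded, so the semicontinuity inequality is applied to its truncations at [n].
   Their nontrivial superlevel sets are complements of compact sets, hence open; monotone
   convergence then removes the truncation. *)
have rn0 n k : 0 <= Num.min (- r k) n%:R by rewrite le_min oppr_ge0 r_le0 ler0n.
have bbrn n : bounded_borel (fun k => Num.min (- r k) n%:R).
  split.
    apply: measurable_minr; last exact: measurable_cst.
    exact: measurableT_comp.
  by exists n%:R => k; rewrite ger0_norm ?ge_min ?lexx ?orbT.
have rno n c : open [set k | c < Num.min (- r k) n%:R].
  have [c0|c0] := ltP c 0.
    rewrite (_ : mkset _ = setT); first exact: openT.
    by apply/seteqP; split => // k _ /=; exact: (lt_le_trans c0).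
  have [cn|nc] := ltP c n%:R; last first.
    rewrite (_ : mkset _ = set0); first exact: open0.
    by rewrite -subset0 => k /=; rewrite lt_min (ltNge c n%:R) nc andbF.
  rewrite (_ : mkset _ = ~` [set k | - c <= r k]).
    by apply: closed_openC; apply: compact_closed => //; exact: r_compact.
  apply/seteqP; split => k /=; rewrite lt_min cn andbT ltrNr ltNge.
    by move/negP.
  by move/negP.
have rle : (\int[m]_k (- r k)%:E <= (- ((1 - delta) * q))%:E)%E.
  have -> : (\int[m]_k (- r k)%:E =
      \int[m]_k limn (fun n => (Num.min (- r k) n%:R)%:E))%E.
    apply: eq_integral => k _; apply/esym/lim_near_cst => //.
    near=> n; rewrite min_l//; near: n; exact: nbhs_infty_ger.
  rewrite monotone_convergence//; last 3 first.
  - by move=> n; apply/measurable_EFinP; case: (bbrn n).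
  - by move=> n k _; rewrite lee_fin.
  - move=> k _ i j ij; rewrite lee_fin le_min ge_min lexx/= ge_min ler_nat ij.
    by rewrite orbT.
  apply: lime_le.
    apply: ereal_nondecreasing_is_cvgn => i j ij; apply: ge0_le_integral => //.
    - by move=> k _; rewrite lee_fin.
    - by apply/measurable_EFinP; case: (bbrn i).
    - by apply/measurable_EFinP; case: (bbrn j).
    - move=> k _; rewrite lee_fin le_min ge_min lexx/= ge_min ler_nat ij.
      by rewrite orbT.
  apply: nearW => n; apply: (le_trans (mlsc _ (rn0 n) (bbrn n).2 (rno n))).
  rewrite lee_fin; apply: ulim_le; first exact: bN.
  apply: filterS Gr => p [fpp Er] /=; rewrite NE//.
  apply: (@le_trans _ _ (E p (fun k => -1 * r k))).
    by apply: finite_expectation_le => // k; rewrite mulN1r ge_min lexx.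
  by rewrite finite_expectationZ mulN1r lerN2.
have ir : m.-integrable setT (EFin \o r).
  apply/integrableP; split; first exact/measurable_EFinP.
  rewrite (eq_integral (fun k : borel K => (- r k)%:E)); first exact: (le_lt_trans rle (ltry _)).
  by move=> k _ /=; rewrite ler0_norm.
have mrq : (1 - delta) * q <= \int[m]_k r k.
  rewrite -lerN2 -RintegralN// -lee_fin; apply: le_trans rle.
  rewrite /Rintegral fineK//; apply: (integrable_fin_num measurableT).
  exact: (integrableN ir).
(* Undoes the normalization to probabilities: all limit relations for [m] carry the factor
   [1 - delta]. *)
pose c := (1 - delta)^-1; have c0 : 0 <= c by rewrite invr_ge0 ltW.
have cK x : c * ((1 - delta) * x) = x by rewrite mulKf// gt_eqF.
have [mu0 muE] := Rintegral_cscale m c0.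
exists (cscale c (charge_of_finite_measure m)); last first.
  have [i1 i2] := muE _ ir; rewrite pairing_nonneg// i2.
  by rewrite -[leLHS]cK ler_wpM2l.
split => //.
- apply: (proj2 (weighted_nonneg mu0 (measurable_weight mr) _)).
    by move=> k; rewrite (le_trans _ (weight_ge1 r_le0 k)).
  have i1 := finite_measure_integrable_cst m 1 measurableT.
  exact: (muE _ (integrableB measurableT i1 ir)).1.
- move=> B mB; set mu := cscale c _.
  (* [L0 mu - nu] annihilates every bounded continuous function, so its two Jordan parts integrate
     these equally; as finite measures on a Borel space they coincide, and the charge vanishes. *)
  pose cc : {charge set (borel S) -> \bar R} :=
    cadd (L0 Q delta mu) (copp (charge_of_finite_measure nu)).
  have pcc h : continuous h -> bounded_fct h -> pairing cc h = 0.
    move=> ch bh; have Ch : Cb h by [].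
    have bst : bounded_borel (fun k : K => h (st k)).
      have bbh := continuous_bounded_borel ch bh; split.
        by apply: measurableT_comp (@measurable_state _ _ _ A0); case: bbh.
      by case: bh => D hD; exists D => k; exact: hD.
    have [_ E1] := @pairing_L0 R S U A A0 Q delta mu mu0 nu h (ltW delta0)
      (fun k => Cb_integrable (Q1 k) Ch) (bounded_borel_integrable (measure_of mu) bst)
      (bounded_borel_integrable (measure_kernel Q (measure_of mu)) (Cb_borel Ch))
      (Cb_integrable nu1 Ch).
    have [cL bL] := bL0 _ Ch.
    have iL := bounded_borel_integrable m (continuous_bounded_borel cL bL).
    by rewrite [LHS]E1 (muE _ iL).2 mL0// cK subrr.
  have jj := borel_space_measure_unique bS (m := jordan_pos (hahn cc))
    (m' := jordan_neg (hahn cc)).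
  have e : cc B = 0%E.
    rewrite (jordan_decomp (hahn cc) mB).
    transitivity (jordan_pos (hahn cc) B - jordan_neg (hahn cc) B)%E.
      by rewrite /cadd/= cscaleN1.
    rewrite [X in (X - _)%E]jj ?subee ?fin_num_measure// => h ch bh.
    by apply/eqP; rewrite -subr_eq0; apply/eqP; exact: pcc.
  have : (L0 Q delta mu B - nu B = 0)%E by exact: e.
  have := fin_num_measure (L0 Q delta mu) _ mB; have := fin_num_measure nu _ mB.
  by case: (nu B) => [x||]//; case: (L0 Q delta mu B) => [x'||]// _ _ [/eqP];
    rewrite subr_eq0 => /eqP ->.
- move=> eta; rewrite in_itv/= => etaab.
  pose eta' : I := exist (fun x => x \in `[a, b]%classic) eta (mem_set etaab).
  rewrite -[eta]/(set_val eta') pairing_neg_part//.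
  have inp := bounded_borel_integrable m (bnp eta').
  rewrite [leRHS](muE _ inp).2.
  by rewrite -[leLHS]cK ler_wpM2l//; exact: mnp.
Unshelve. all: by end_near. Qed.

End primal_existence.

(** * Attainment of the dual optimum *)

Section weak_star_compactness.
Context (R : realType) (a b : R) (ab : a <= b).
Local Notation I := (compact_itv ab).
Variables (Lam : nat -> {charge set (borel I) -> \bar R}) (M : R).
Hypothesis Lam0 : forall n, nonneg_charge (Lam n).
Hypothesis LamM : forall n, pairing (Lam n) (cst 1) <= M.

(** An ultrafilter finer than [\oo] yields the limit measure, tightness being automatic on a compact
    interval. Indices realizing the limit on the countably many [g j] are then chosen diagonally;
    [n <= phi n] is all that is kept of a subsequence. *)
Lemma weak_star_subsequence (g : nat -> I -> R) :
  (forall j, continuous (g j)) -> (forall j, bounded_fct (g j)) ->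
  exists (Lam' : {charge set (borel I) -> \bar R}) (phi : nat -> nat),
    [/\ nonneg_charge Lam', (forall n, n <= phi n)%N &
      forall j, pairing (Lam (phi n)) (g j) @[n --> \oo] --> pairing Lam' (g j)].
Proof.
move=> cg bg.
have [U [UU ooU]] := @ultraFilterLemma nat \oo _.
pose m n := measure_of (Lam n).
pose E n (f : I -> R) := \int[m n]_x f x.
have int n f : bounded_borel f -> (m n).-integrable setT (EFin \o f).
  exact: bounded_borel_integrable.
have pE n f : bounded_borel f -> pairing (Lam n) f = E n f.
  by move=> bf; exact: pairing_bounded_borel.
have E1 n : E n (cst 1) <= M.
  by rewrite -pE; [exact: LamM|exact: bounded_borel_cst].
have Ege0 n f : bounded_borel f -> (forall x, 0 <= f x) -> 0 <= E n f.
  by move=> _ f0; apply: Rintegral_ge0.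
have ED n f f' : bounded_borel f -> bounded_borel f' ->
    E n (fun x => f x + f' x) = E n f + E n f'.
  by move=> bf bf'; rewrite /E RintegralD//; exact: int.
have EZ n c f : bounded_borel f -> E n (fun x => c * f x) = c * E n f.
  by move=> bf; rewrite /E RintegralZl//; exact: int.
have Et e : 0 < e -> exists2 C : set I, compact C & U [set n | E n \1_(~` C) <= e].
  move=> e0; exists setT; first exact: compact_itv_compact.
  apply: filterE => n /=; rewrite setCT indic0 /E Rintegral_cst// mul0r ltW//.
have [m' [m'1 [_ m'C]]] :=
  @ultralimit_measure R _ U UU I E M (@compact_itv_hausdorff R a b ab) Ege0 ED EZ E1 Et.
(* The [k]-th set controls the first [k] test functions up to [1 / (k + 1)]. It belongs to [U],
   hence is nonempty, which provides [phi k]. *)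
pose near_all k := [set n | (k <= n)%N /\
  forall j, (j < k)%N -> `|E n (g j) - \int[m']_x g j x| < k.+1%:R^-1].
have bbg j : bounded_borel (g j) by exact: continuous_bounded_borel.
have Unear k : U (near_all k).
  apply: filterI; first by apply: ooU; exact: nbhs_infty_ge.
  suff : forall i, U [set n | forall j, (j < i)%N ->
    `|E n (g j) - \int[m']_x g j x| < k.+1%:R^-1] by apply.
  elim=> [|i IH]; first by apply: filterE.
  have Ui : U [set n | `|E n (g i) - \int[m']_x g i x| < k.+1%:R^-1].
    have := ultra_bounded_cvg UU (bounded_functional Ege0 ED EZ E1 (bbg i)).
    rewrite -m'C// => /cvgrPdist_lt /(_ k.+1%:R^-1).
    rewrite invr_gt0 ltr0n => /(_ isT); apply: filterS => n /=.
    by rewrite distrC.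
  apply: filterS2 IH Ui => n /= h1 h2 j; rewrite ltnS leq_eqVlt => /orP[/eqP->//|].
  exact: h1.
have /choice[phi phiP] : forall k, exists n, near_all k n.
  by move=> k; have [n hn] := @filter_ex _ _ (@ultra_proper _ _ UU) _ (Unear k); exists n.
exists (charge_of_finite_measure m'), phi; split.
- exact: nonneg_charge_of_finite_measure.
- by move=> n; case: (phiP n).
- move=> j; rewrite (pairing_measure (m := m'))//; last exact: bounded_borel_integrable.
  apply/cvgrPdist_lt => e e0; near=> n.
  rewrite pE// distrC; have [_ h] := phiP n.
  apply: (lt_trans (h j _)); first by near: n; exact: nbhs_infty_gt.
  by near: n; exact: near_infty_natSinv_lt (PosNum e0).
Unshelve. all: by end_near. Qed.

End weak_star_compactness.

Lemma near_limn_einf_ge (R : realType) (u : (\bar R)^nat) (v : \bar R) :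
  (\forall n \near \oo, (v <= u n)%E) -> (v <= limn_einf u)%E.
Proof.
move=> [N _ uN]; rewrite limn_einf_lim.
have nd := @nondecreasing_einfs R u.
rewrite (cvg_lim _ (ereal_nondecreasing_cvgn nd))//.
apply: (le_trans _ (ereal_sup_ubound _)); last by exists N.
by apply: le_ereal_inf_tmp => _ [n /= Nn <-]; exact: uN.
Qed.

Lemma limn_einf_gt_near (R : realType) (u : (\bar R)^nat) (v : \bar R) :
  (v < limn_einf u)%E -> \forall n \near \oo, (v < u n)%E.
Proof.
rewrite limn_einf_lim.
have nd := @nondecreasing_einfs R u.
rewrite (cvg_lim _ (ereal_nondecreasing_cvgn nd))//.
move=> /ereal_sup_gt[_ [N _ <-] vN]; exists N => // n /= Nn.
by apply: (lt_le_trans vN); apply: ereal_inf_lbound; exists n.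
Qed.

Lemma neg_part_lipschitz (R : realType) (x x' : R) :
  `|neg_part x - neg_part x'| <= `|x - x'|.
Proof.
rewrite /neg_part; case: (leP x 0) => x0; case: (leP x' 0) => x'0 //.
- by rewrite subr0 !ler0_norm; lra.
- by rewrite sub0r normrN (ler0_norm x'0) ger0_norm; lra.
- by rewrite subrr normr0.
Qed.

Lemma pairing_le_uniform (R : realType) (T : ptopologicalType)
    (Lam : {charge set (borel T) -> \bar R}) (f g : T -> R) (e : R) :
  nonneg_charge Lam -> bounded_borel f -> bounded_borel g ->
  (forall x, `|f x - g x| <= e) ->
  `|pairing Lam f - pairing Lam g| <= e * pairing Lam (cst 1).
Proof.
move=> Lam0 bf bg fg; have b1 := bounded_borel_cst T (1 : R).
rewrite !pairing_nonneg//; try exact: bounded_borel_integrable.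
have ifm := bounded_borel_integrable (measure_of Lam) bf.
have igm := bounded_borel_integrable (measure_of Lam) bg.
rewrite -RintegralB//.
have bfg : bounded_borel (fun x => f x + -1 * g x).
  by apply: bounded_borelD => //; exact: bounded_borelZ.
have ifg : (measure_of Lam).-integrable setT (EFin \o (fun x => f x - g x)).
  exact: (integrableB measurableT ifm igm).
apply: (le_trans (le_normr_Rintegral _ ifg)) => //.
rewrite -RintegralZl//; last exact: bounded_borel_integrable.
apply: le_Rintegral => //.
- by have := integrable_abse ifg.
- exact: (integrableZl measurableT e (bounded_borel_integrable (measure_of Lam) b1)).
- by move=> x _; rewrite mulr1.
Qed.

Lemma contraction_comp_continuous (R : realType) (T : topologicalType)
    (f : T -> R) (g : R -> R) : (forall x y, `|g x - g y| <= `|x - y|) ->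
  continuous f -> continuous (fun t => g (f t)).
Proof.
move=> gl cf t; apply/cvgrPdist_lt => e e0; near=> t'.
apply: (le_lt_trans (gl _ _)).
by near: t'; apply: cvgr_dist_lt => //; exact: cf.
Unshelve. all: by end_near. Qed.

(** * Pointwise lower limits and Fatou's lemma *)

Section lower_limit.
Context d (T : measurableType d) (R : realType).
Variables (W : T -> R) (g : nat -> T -> R).
Hypothesis mg : forall n, measurable_fun setT (g n).
Hypothesis gW : forall n x, 0 <= g n x <= W x.

(** [fine] loses nothing, since [gW] keeps the lower limit between 0 and [W x]. *)
Definition lower_limit (x : T) : R := fine (limn_einf (fun n => (g n x)%:E)).

Lemma lower_limitE x : (lower_limit x)%:E = limn_einf (fun n => (g n x)%:E).
Proof.
rewrite /lower_limit fineK// fin_numElt; apply/andP; split.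
  apply: (@lt_le_trans _ _ 0%E) => //; apply: near_limn_einf_ge.
  by near=> n; rewrite lee_fin; have /andP[] := gW n x.
rewrite ltNge; apply/negP => Wy.
have : ((W x + 1)%:E < limn_einf (fun n => (g n x)%:E))%E.
  by apply: lt_le_trans Wy; rewrite ltry.
move=> /limn_einf_gt_near/(@filter_ex _ _ _)[n].
by rewrite lte_fin; have /andP[_] := gW n x; lra.
Unshelve. all: by end_near. Qed.

Lemma lower_limit_bounds x : 0 <= lower_limit x <= W x.
Proof.
apply/andP; split.
  rewrite -lee_fin lower_limitE; apply: near_limn_einf_ge.
  by near=> n; rewrite lee_fin; have /andP[] := gW n x.
rewrite leNgt; apply/negP; rewrite -lte_fin lower_limitE.
move=> /limn_einf_gt_near/(@filter_ex _ _ _)[n].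
by rewrite lte_fin; have /andP[_] := gW n x; lra.
Unshelve. all: by end_near. Qed.

Lemma measurable_lower_limit : measurable_fun setT lower_limit.
Proof.
apply/measurable_EFinP.
rewrite (_ : EFin \o _ = fun x => (- limn_esup (fun n => (- g n x)%:E))%E).
  apply: measurableT_comp => //; apply: measurable_fun_limn_esup => n.
  by apply/measurable_EFinP; exact: measurableT_comp.
apply/funext => x /=; rewrite lower_limitE -limn_einfN; congr limn_einf.
by apply/funext => n /=; rewrite opprK.
Qed.

(** Fatou's lemma with a tolerance [e] in place of the lower limit of the integrals, a form that
    combines with other estimates valid for all large [n]. *)
Lemma Rintegral_lower_limit (m : {measure set T -> \bar R}) (e : R) :
  m.-integrable setT (EFin \o W) -> 0 < e ->
  \forall n \near \oo, \int[m]_x lower_limit x - e <= \int[m]_x g n x.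
Proof.
move=> iW e0.
have dom (f : T -> R) : measurable_fun setT f -> (forall x, 0 <= f x <= W x) ->
    m.-integrable setT (EFin \o f).
  move=> mf fW; apply: le_integrable iW => //; first exact/measurable_EFinP.
  move=> x _; have /andP[f0 fWx] := fW x.
  by rewrite /= lee_fin !ger0_norm// (le_trans f0).
have ig n := dom _ (mg n) (gW n).
have il := dom _ measurable_lower_limit lower_limit_bounds.
have : ((\int[m]_x lower_limit x - e)%:E < limn_einf (fun n => \int[m]_x (g n x)%:E))%E.
  apply: (@lt_le_trans _ _ (\int[m]_x limn_einf (fun n => (g n x)%:E)))%E.
    rewrite (eq_integral (fun x => (lower_limit x)%:E)); last by move=> x _; rewrite lower_limitE.
    rewrite -(fineK (integrable_fin_num measurableT il)) lte_fin.
    by rewrite /Rintegral ltrBlDr ltrDl.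
  apply: fatou => //; first by move=> n; exact/measurable_EFinP.
  by move=> n x _; rewrite lee_fin; have /andP[] := gW n x.
move=> /limn_einf_gt_near; apply: filterS => n.
rewrite -(fineK (integrable_fin_num measurableT (ig n))) lte_fin => /ltW.
by [].
Qed.

End lower_limit.

(** There is one test function for each real [x], but rational ones suffice: moving [x] changes the
    function uniformly by at most the displacement, and the masses are bounded by [M]. *)
Lemma weak_star_neg_part (R : realType) (a b : R) (ab : a <= b)
    (Lam : nat -> {charge set (borel (compact_itv ab)) -> \bar R}) (M : R)
    (f : compact_itv ab -> R) :
  (forall n, nonneg_charge (Lam n)) -> (forall n, pairing (Lam n) (cst 1) <= M) ->
  continuous f -> bounded_fct f ->
  exists (Lam' : {charge set (borel (compact_itv ab)) -> \bar R}) (phi : nat -> nat),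
    [/\ nonneg_charge Lam', (forall n, n <= phi n)%N,
      pairing (Lam (phi n)) f @[n --> \oo] --> pairing Lam' f &
      forall x, pairing (Lam (phi n)) (fun eta => neg_part (x - set_val eta))
        @[n --> \oo] --> pairing Lam' (fun eta => neg_part (x - set_val eta))].
Proof.
move=> Lam0 LamM cf bf.
pose np x (eta : compact_itv ab) : R := neg_part (x - set_val eta).
have cnp x : continuous (np x).
  apply: (@contraction_comp_continuous R _ set_val (fun t => neg_part (x - t))).
    move=> t t'; apply: (le_trans (neg_part_lipschitz _ _)).
    have -> : x - t - (x - t') = t' - t by ring.
    by rewrite distrC.
  exact: itv_val_continuous.
have bnp x : bounded_fct (np x).
  exists (`|x| + (`|a| + `|b|)) => eta.
  by rewrite (le_trans (ler_norm_neg_part _))// (le_trans (ler_normB _ _))// lerD2l itv_val_norm.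
have bbnp x : bounded_borel (np x) by exact: continuous_bounded_borel.
(* Index 0 carries [f], and [j.+1] the rational coded by [j], with 0 for the codes of no
   rational. *)
pose g i := if i is j.+1 then np (ratr (odflt 0%Q (@choice.unpickle rat j))) else f.
have cg j : continuous (g j) by case: j => [|j]; [exact: cf|exact: cnp].
have bg j : bounded_fct (g j) by case: j => [|j]; [exact: bf|exact: bnp].
have [Lam' [phi [Lam'0 phin cvg_g]]] := @weak_star_subsequence R a b ab Lam M Lam0 LamM g cg bg.
exists Lam', phi; split => //; first exact: (cvg_g 0).
move=> x; apply/cvgrPdist_le => e e0.
(* [N] bounds the masses of all [Lam n] and of [Lam'], so replacing [x] by a rational within [e']
   costs at most [e / 3] on either side; the last third is convergence at that rational. *)
pose N := `|M| + `|pairing Lam' (cst 1)| + 1.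
have N0 : 0 < N by rewrite ltr_wpDl// addr_ge0.
pose e' := e / 3 / N; have e'0 : 0 < e' by rewrite !divr_gt0.
have [q] : exists q, ratr q \in `]x, (x + e')[.
  by apply: rat_in_itvoo; rewrite ltrDl.
rewrite in_itv/= => /andP[xq qx].
have close (Lam1 : {charge set (borel (compact_itv ab)) -> \bar R}) : nonneg_charge Lam1 ->
    `|pairing Lam1 (np x) - pairing Lam1 (np (ratr q))| <= e' * pairing Lam1 (cst 1).
  move=> Lam10; apply: pairing_le_uniform => // eta.
  apply: (le_trans (neg_part_lipschitz _ _)).
  have -> : x - set_val eta - (ratr q - set_val eta) = x - ratr q by ring.
  by rewrite distrC ger0_norm; lra.
have h1 n : e' * pairing (Lam n) (cst 1) <= e / 3.
  rewrite /e' -mulrA ler_piMr ?divr_ge0 ?(ltW e0)//.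
  rewrite mulrC ler_pdivrMr// mul1r (le_trans (LamM _))//.
  by rewrite (le_trans (ler_norm M))// /N -addrA lerDl addr_ge0.
have h2 : e' * pairing Lam' (cst 1) <= e / 3.
  rewrite /e' -mulrA ler_piMr ?divr_ge0 ?(ltW e0)//.
  rewrite mulrC ler_pdivrMr// mul1r (le_trans (ler_norm _))//.
  by rewrite /N addrAC lerDr addr_ge0.
have := cvg_g (choice.pickle q).+1; rewrite /g choice.pickleK/= => /cvgrPdist_le /(_ (e / 3)).
rewrite divr_gt0// => /(_ isT); apply: filterS => n /= hn.
rewrite -/(np x).
have -> : pairing Lam' (np x) - pairing (Lam (phi n)) (np x) =
  (pairing Lam' (np x) - pairing Lam' (np (ratr q))) +
  (pairing Lam' (np (ratr q)) - pairing (Lam (phi n)) (np (ratr q))) -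
  (pairing (Lam (phi n)) (np x) - pairing (Lam (phi n)) (np (ratr q))) by ring.
have c1 := close _ Lam'0; have c2 := close _ (Lam0 (phi n)).
apply: (le_trans (ler_normB _ _)).
have -> : e = e / 3 + e / 3 + e / 3 by field.
apply: lerD; last exact: le_trans c2 (h1 _).
apply: (le_trans (ler_normD _ _)); apply: lerD => //.
exact: le_trans c1 h2.
Unshelve. all: by end_near. Qed.

Section attainment.
Context (R : realType) (S U : ptopologicalType) (A : S -> set U).
Variables (A0 : forall s, A s !=set0) (Q : R.-pker (borel (admissible A0)) ~> (borel S)).
Variables (delta : R) (r z : admissible A0 -> R) (nu : probability (borel S) R).
Variables (a b : R) (ab : a <= b) (y : R -> R).
Local Notation K := (admissible A0).
Local Notation I := (compact_itv ab).
Local Notation sw := (state_weight r : borel S -> R).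
Hypothesis delta_gt0 : 0 < delta.
Hypothesis r_le0 : forall k, r k <= 0.
Hypothesis swQ : forall k, (Q k).-integrable setT (EFin \o sw).
Hypothesis swnu : nu.-integrable setT (EFin \o sw).
Hypothesis yc : continuous (fun eta : I => y (set_val eta)).
Hypothesis yb : bounded_fct (fun eta : I => y (set_val eta)).

Lemma dual_attained (h : nat -> S -> R) (Lam : nat -> {charge set (borel I) -> \bar R}) :
  (forall n, dual_feasible Q delta r z (h n) (Lam n)) ->
  (dual_objective nu y (h n) (Lam n))%:E @[n --> \oo] --> dual_value Q delta r z nu ab y ->
  bounded_fct (fun n => weighted_norm sw (h n)) -> weakly_star_bounded Lam ->
  exists h' (Lam' : {charge set (borel I) -> \bar R}), dual_feasible Q delta r z h' Lam' /\
    (dual_objective nu y h' Lam')%:E = dual_value Q delta r z nu ab y.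
Proof.
move=> feas objcvg [C hC] Lamb.
have Lam0 n : nonneg_charge (Lam n) by have [] := feas n.
(* Testing against the constant 1 bounds the total masses. *)
have [M LamM] := Lamb (cst 1) (@cst_continuous _ _ _).
have {}LamM n : pairing (Lam n) (cst 1) <= M by exact: le_trans (ler_norm _) (LamM n).
have sw1 := state_weight_ge1 r_le0.
have hCs n s : `|h n s| <= C * sw s.
  rewrite -ler_pdivrMr; last exact: lt_le_trans (sw1 s).
  apply: le_trans (le_trans (ler_norm _) (hC n)).
  by have [[_ ub] _ _] := feas n; apply: ub_le_sup => //; exists s.
have [Lam' [phi [Lam'0 phin cvgy cvgL]]] := weak_star_neg_part Lam0 LamM yc yb.
have msw : measurable_fun setT sw by exact: measurable_state_weight swnu.
have mh n : measurable_fun [set: borel S] (h n) by have [[]] := feas n.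
(* Fatou's lemma needs nonnegative functions: adding [C * sw] places the [h (phi n)] between 0 and
   the integrable [W]. The shift is taken off again in [h']. *)
pose W s := 2 * C * sw s.
pose g n (s : borel S) := h (phi n) s + C * sw s.
have mg n : measurable_fun setT (g n).
  by apply: measurable_funD => //; exact: measurable_funM.
have gW n s : 0 <= g n s <= W s.
  have := hCs (phi n) s; rewrite ler_norml => /andP[h1 h2].
  by rewrite /g /W; apply/andP; split; lra.
pose gl := lower_limit g.
have mgl : measurable_fun setT gl by exact: measurable_lower_limit gW.
have glW := lower_limit_bounds gW.
pose h' (s : borel S) := gl s - C * sw s.
have h'C s : `|h' s| <= C * sw s.
  have /andP[h1 h2] := glW s; rewrite /h' ler_norml /gl; move: h2; rewrite /W => h2.
  by apply/andP; split; lra.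
have wh' : weighted_functions sw h'.
  split; first by apply: measurable_funB => //; exact: measurable_funM.
  exists C => _ [s _ <-]; rewrite ler_pdivrMr//.
  exact: lt_le_trans (sw1 s).
have lim_h (m : {measure set (borel S) -> \bar R}) e : m.-integrable setT (EFin \o sw) ->
    0 < e -> \forall n \near \oo, \int[m]_s h' s - e <= \int[m]_s h (phi n) s.
  move=> im e0.
  have iW c : m.-integrable setT (EFin \o (fun s => c * sw s)).
    exact: (integrableZl measurableT c im).
  have dom (f : borel S -> R) : measurable_fun setT f -> (forall s, 0 <= f s <= W s) ->
      m.-integrable setT (EFin \o f).
    move=> mf fW; apply: (le_integrable measurableT _ _ (iW (2 * C))).
      exact/measurable_EFinP.
    move=> s _; have /andP[f0 fWs] := fW s.
    by rewrite /= lee_fin !ger0_norm// (le_trans f0).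
  have := Rintegral_lower_limit mg gW (iW (2 * C)) e0.
  apply: filterS => n hn.
  have -> : \int[m]_s h' s = \int[m]_s gl s - \int[m]_s (C * sw s).
    rewrite -RintegralB//; exact: dom.
  have -> : \int[m]_s h (phi n) s = \int[m]_s g n s - \int[m]_s (C * sw s).
    rewrite -RintegralB//; last exact: dom.
    by apply: eq_Rintegral => s _; rewrite /g addrK.
  by rewrite addrAC lerD2r.
have feas' : dual_feasible Q delta r z h' Lam'.
  split => // k; rewrite /L0_adj.
  apply/ler_addgt0Pr => e e0; rewrite add0r.
  set s := state k.
  (* The factor [delta] before the [Q]-integral turns this tolerance into [e / 2]; the convergence
     of the multipliers uses the other half. *)
  have e2 : 0 < e / (2 * delta) by rewrite divr_gt0// mulr_gt0.
  suff : r k + delta * \int[Q k]_s h' s + L1_adj z Lam' k - e + C * sw s <= gl s.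
    by rewrite /h'; lra.
  (* Feasibility of the [n]-th pair is a lower bound on [h (phi n) s], so a bound holding for all
     large [n] passes to the lower limit. *)
  rewrite -lee_fin (lower_limitE gW); apply: near_limn_einf_ge.
  have /cvgrPdist_le /(_ (e / 2)) := cvgL (z k).
  rewrite divr_gt0// => /(_ isT) near1.
  apply: filterS2 (lim_h (Q k) _ (swQ k) e2) near1 => n hn.
  rewrite ler_norml => /andP[_ hL].
  have [_ _ /(_ k)] := feas (phi n); rewrite /L0_adj -/s => fn.
  have hn' : delta * \int[Q k]_s h' s - e / 2 <= delta * \int[Q k]_s h (phi n) s.
    apply: le_trans (ler_wpM2l (ltW delta_gt0) hn).
    rewrite mulrBr lerD2l lerN2.
    have -> : delta * (e / (2 * delta)) = e / 2 by field; apply: lt0r_neq0.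
    by [].
  rewrite lee_fin /g; move: hL fn hn'; rewrite /L1_adj.
  set p1 := pairing Lam' _; set p2 := pairing (Lam (phi n)) _.
  set i1 := delta * _; set i2 := delta * _.
  by move=> *; lra.
exists h', Lam'; split => //; apply/eqP; rewrite eq_le; apply/andP; split; last first.
  by apply: ereal_inf_lbound; exists (h', Lam').
(* Objectives along [phi] still converge to the dual value, which the objective of the limit pair
   exceeds by at most any [e]. *)
have phioo : phi @ \oo --> \oo.
  by move=> B [N _ NB]; exists N => // n /= Nn; apply: NB; exact: leq_trans (phin n).
have cvgo := cvg_comp _ _ phioo objcvg.
apply/lee_addgt0Pr => e e0; rewrite -leeBlDr//.
rewrite -(cvg_lim _ cvgo)//; apply: lime_ge; first by apply/cvg_ex; eexists; exact: cvgo.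
have e2 : 0 < e / 2 by rewrite divr_gt0.
have /cvgrPdist_le /(_ (e / 2) e2) near1 := cvgy.
apply: filterS2 (lim_h nu _ swnu e2) near1 => n hn.
rewrite ler_norml => /andP[hL _].
rewrite -EFinB lee_fin /dual_objective.
move: hn hL; set p1 := pairing Lam' _; set p2 := pairing (Lam (phi n)) _.
set i1 := Rintegral _ _ _; set i2 := Rintegral _ _ _.
by move=> *; lra.
Qed.

End attainment.

(** * The benchmark *)

Lemma Rintegral_lipschitz d (T : measurableType d) (R : realType) (P : probability T R)
    (f g : T -> R) (e : R) : P.-integrable setT (EFin \o f) -> P.-integrable setT (EFin \o g) ->
  (forall x, `|f x - g x| <= e) -> `|\int[P]_x f x - \int[P]_x g x| <= e.
Proof.
move=> intf intg fg; rewrite -RintegralB//.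
have ifg : P.-integrable setT (EFin \o (fun x => f x - g x)).
  exact: (integrableB measurableT intf intg).
apply: (le_trans (le_normr_Rintegral _ ifg)) => //.
rewrite -[leRHS]mulr1.
have -> : e * 1 = \int[P]_x cst e x.
  by rewrite Rintegral_cst// [X in fine X](_ : _ = 1%E)//; exact: probability_setT.
apply: le_Rintegral => //; first by have := integrable_abse ifg.
exact: finite_measure_integrable_cst.
Qed.

Section benchmark.
Context (R : realType) d (Omega : measurableType d) (P : probability Omega R) (Y : {RV P >-> R}).
Context (a b : R) (ab : a <= b).
Hypothesis suppY : P (Y @^-1` `[a, b]) = 1%E.

(** [Y] lies in the interval only almost surely. Clamping alters it on a null set and makes all
    integrands bounded. *)
Let Y' omega := Num.max a (Num.min b (Y omega)).

Let Y'ab omega : a <= Y' omega <= b.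
Proof. by rewrite /Y' le_max lexx/= ge_max ab ge_min lexx. Qed.

Let mY' : measurable_fun setT Y'.
Proof. by apply: measurable_maxr => //; apply: measurable_minr. Qed.

Let Y'_integrable eta : P.-integrable setT (EFin \o (fun omega => neg_part (Y' omega - eta))).
Proof.
apply: bounded_integrable.
  by apply: neg_part_measurable; apply: measurable_funB.
exists (`|a| + `|b| + `|eta|) => omega.
rewrite (le_trans (ler_norm_neg_part _))// (le_trans (ler_normB _ _))// lerD2r.
have /andP[h1 h2] := Y'ab omega.
have := ler_norm b; have := ler_norm (- a); rewrite normrN => ha hb.
have := normr_ge0 a; have := normr_ge0 b => hb0 ha0.
by rewrite ler_norml; apply/andP; split; lra.
Qed.

Let benchmarkE eta : benchmark Y eta = \int[P]_omega neg_part (Y' omega - eta).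
Proof.
rewrite /benchmark unlock /Rintegral; congr fine; apply: ae_eq_integral => //.
- by apply/measurable_EFinP/neg_part_measurable/measurable_funB.
- exact: measurable_int (Y'_integrable eta).
- have mD : measurable (Y @^-1` `[a, b]).
    by rewrite -[X in measurable X]setTI; exact: measurable_funP.
  exists (~` (Y @^-1` `[a, b])); split; first exact: measurableC.
    by apply: (etrans (probability_setC P mD)); rewrite suppY subee.
  move=> omega /=; apply: contra_not; rewrite in_itv/= => /andP[aY Yb] _.
  by rewrite /Y' min_r// max_r.
Qed.

Lemma benchmark_lipschitz eta eta' : `|benchmark Y eta - benchmark Y eta'| <= `|eta - eta'|.
Proof.
rewrite !benchmarkE; apply: Rintegral_lipschitz => // omega.
apply: (le_trans (neg_part_lipschitz _ _)).
have -> : Y' omega - eta - (Y' omega - eta') = eta' - eta by ring.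
by rewrite distrC.
Qed.

Lemma benchmark_continuous : continuous (fun eta : compact_itv ab => benchmark Y (set_val eta)).
Proof.
apply: (@contraction_comp_continuous R _ set_val (benchmark Y)).
  exact: benchmark_lipschitz.
exact: itv_val_continuous.
Qed.

Lemma benchmark_bounded : bounded_fct (fun eta : compact_itv ab => benchmark Y (set_val eta)).
Proof.
exists (`|benchmark Y a| + (b - a)) => eta.
have /andP[h1 h2] := itv_val_bounds eta.
rewrite -[X in `|X|](subrKC (benchmark Y a)) (le_trans (ler_normD _ _))// lerD2l.
apply: (le_trans (benchmark_lipschitz _ _)).
by rewrite ger0_norm; lra.
Qed.

End benchmark.

(** As [mu] is nonnegative, [L0 mu = nu] shows that [nu] is dominated by the marginal of [mu], and
    the state weight is at most [weight r], which [mu] integrates. Primal feasibility thus makes the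
    dual objective meaningful. *)
Lemma initial_integrable (R : realType) (S U : ptopologicalType) (A : S -> set U)
    (A0 : forall s, A s !=set0) (Q : R.-pker (borel (admissible A0)) ~> (borel S))
    (delta : R) (r : admissible A0 -> R) (nu : probability (borel S) R)
    (mu : {charge set (borel (admissible A0)) -> \bar R}) :
  0 <= delta -> (forall k, r k <= 0) -> measurable_fun [set: borel (admissible A0)] r ->
  measurable_fun [set: borel S] (state_weight r) ->
  weighted_measures (weight r : borel (admissible A0) -> R) mu -> nonneg_charge mu ->
  (forall B, measurable B -> L0 Q delta mu B = nu B) ->
  nu.-integrable setT (EFin \o (state_weight r : borel S -> R)).
Proof.
move=> d0 r0 mr msw wmu mu0 L0mu.
have mw := measurable_weight mr.
have w0 k : 0 <= weight r k by rewrite (le_trans _ (weight_ge1 r0 k)).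
have iw := (weighted_nonneg mu0 mw w0).1 wmu.
have mst := @measurable_state S U A A0.
have isw : (measure_of mu).-integrable setT
    (EFin \o ((state_weight r : borel S -> R) \o
      (@state S U A A0 : borel (admissible A0) -> borel S))).
  apply: le_integrable iw => //; first by apply/measurable_EFinP; exact: measurableT_comp.
  move=> k _; rewrite /= lee_fin ger0_norm; last by rewrite (le_trans _ (state_weight_ge1 r0 _)).
  by rewrite ger0_norm// state_weight_le.
pose m1 : {measure set (borel S) -> \bar R} :=
  pushforward (measure_of mu) (@state S U A A0 : borel (admissible A0) -> borel S).
have [im1 _] :=
  @Rintegral_image _ _ _ _ R _ (measure_of mu) (m1 mst) _ mst (fun _ _ => erefl) msw isw.
apply: le_measure_integrable im1 => B mB.
apply: (@le_trans _ _ (L0 Q delta mu B)); first by rewrite L0mu.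
rewrite L0E// leeBlDr ?fin_numM ?fin_num_measure//.
by rewrite leeDl// mule_ge0.
Qed.
Lemma ereal_between (R : realType) (x y : \bar R) : (x < y)%E ->
  exists2 q : R, (x < q%:E)%E & (q%:E < y)%E.
Proof.
move: x y => [x| |] [y| |]//; rewrite ?lte_fin => xy.
- by exists ((x + y) / 2); rewrite lte_fin; lra.
- by exists (x + 1); rewrite ?ltry// lte_fin; lra.
- by exists (y - 1); rewrite ?ltNyr// lte_fin; lra.
- by exists 0; rewrite ?ltNyr ?ltry.
Qed.

Theorem theorem5p4 (R : realType) (S U : ptopologicalType)
  (A : S -> set U) (A0 : forall s, A s !=set0)
  (Q : R.-pker (borel (admissible A0)) ~> (borel S))
  (r z : admissible A0 -> R) (delta : R) (nu : probability (borel S) R)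
  (a b : R) (ab : a <= b)
  (d : measure_display) (Omega : measurableType d) (P : probability Omega R)
  (Y : {RV P >-> R})
  (borelS : borel_space R S) (borelU : borel_space R U)
  (mA : forall s, measurable (A s : set (borel U)))
  (closedK : closed (graph A))
  (mr : measurable_fun [set: borel (admissible A0)] r)
  (mz : measurable_fun [set: borel (admissible A0)] z)
  (delta01 : 0 < delta < 1)
  (suppY : P (Y @^-1` `[a, b]) = 1%E)
  (assumption1 : exists mu,
     primal_feasible Q delta r z nu a b (benchmark Y) mu)
  (assumption2 : (forall k, r k <= 0) /\
     forall eps : R, 0 <= eps -> compact [set k | - eps <= r k])
  (assumption3 : bounded_fct z /\ upper_semicontinuous z)
  (assumption4 : forall h : S -> R, continuous h -> bounded_fct h ->
     continuous (fun k : admissible A0 => \int[Q k]_s h s) /\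
     bounded_fct (fun k : admissible A0 => \int[Q k]_s h s))
  (assumption5 : forall eta, eta \in `[a, b] ->
     weighted_functions (weight r : borel (admissible A0) -> R)
       (fun k => neg_part (z k - eta)))
  (assumption6 :
     (forall k, (Q k).-integrable [set: borel S] (fun s => (state_weight r s)%:E)) /\
     weighted_functions (weight r : borel (admissible A0) -> R)
       (fun k => \int[Q k]_s state_weight r s))
  (assumption7 : exists (h : nat -> S -> R)
       (Lam : nat -> {charge set (borel (compact_itv ab)) -> \bar R}),
     [/\ forall n, dual_feasible Q delta r z (h n) (Lam n),
         (dual_objective nu (benchmark Y) (h n) (Lam n))%:E @[n --> \oo]
           --> dual_value Q delta r z nu ab (benchmark Y),
         bounded_fct (fun n => weighted_norm (state_weight r : borel S -> R) (h n))
       & weakly_star_bounded Lam]) :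
  [/\ (forall (h : S -> R) (Lam : {charge set (borel (compact_itv ab)) -> \bar R}),
         weighted_functions (state_weight r : borel S -> R) h ->
         nonneg_charge Lam ->
         (dual_feasible Q delta r z h Lam ->
            dual_function Q delta r z nu (benchmark Y) (fun s => - h s) Lam =
            (dual_objective nu (benchmark Y) h Lam)%:E) /\
         (~ dual_feasible Q delta r z h Lam ->
            dual_function Q delta r z nu (benchmark Y) (fun s => - h s) Lam = +oo%E)),
      lagrangian_dual_value Q delta r z nu ab (benchmark Y) =
        dual_value Q delta r z nu ab (benchmark Y),
      primal_value Q delta r z nu a b (benchmark Y) =
        dual_value Q delta r z nu ab (benchmark Y)
    & exists (h : S -> R) (Lam : {charge set (borel (compact_itv ab)) -> \bar R}),
        dual_feasible Q delta r z h Lam /\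
        (dual_objective nu (benchmark Y) h Lam)%:E =
          dual_value Q delta r z nu ab (benchmark Y)].
Proof.
have [r0 rc] := assumption2; have [bz uz] := assumption3.
have [swQ swQw] := assumption6; have [mu0 feas0] := assumption1.
have /andP[d0 d1] := delta01.
have yc := @benchmark_continuous R d Omega P Y a b ab suppY.
have yb := @benchmark_bounded R d Omega P Y a b ab suppY.
have ybb := continuous_bounded_borel yc yb.
have msw : measurable_fun [set: borel S] (state_weight r).
  (* The state weight involves a supremum over actions; its measurability is read off from its
     integrability under the kernel. *)
  by apply/measurable_EFinP; exact: measurable_int (swQ point).
have swnu : nu.-integrable [set: borel S] (EFin \o (state_weight r : borel S -> R)).
  by have [wmu mu00 L0mu _] := feas0; exact: initial_integrable (ltW d0) r0 mr msw wmu mu00 L0mu.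
have hK :=
  @admissible_hausdorff S U A A0 (borel_space_hausdorff borelS) (borel_space_hausdorff borelU).
split.
- move=> h Lam wh Lam0.
  by apply: dual_functionE => //; exact: ltW.
- by apply: lagrangian_dual_valueE => //; exact: ltW.
- apply/eqP; rewrite eq_le; apply/andP; split.
    apply: ge_ereal_sup => _ [mu mufeas <-].
    apply: le_ereal_inf_tmp => _ [[h Lam] feas <-]; rewrite lee_fin.
    by apply: weak_duality mufeas feas => //; exact: ltW.
  (* A gap leaves room for a real [q] strictly between the two values. One branch yields a dual
     feasible pair with objective [q], the other a primal feasible measure with value at least [q],
     and each contradicts one of the strict inequalities. *)
  rewrite leNgt; apply/negP => /ereal_between[q pq qd].
  have [[h [Lam [ch bh Lam0 neg]]]|pos] := pselect (exists h Lam,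
    [/\ continuous h, bounded_fct h, nonneg_charge Lam &
      forall k, @relaxed_slack R S U A A0 Q delta r z nu a b ab (benchmark Y) q h Lam k <= 0]).
    have [h' [feas objq]] := relaxed_slack_feasible r0 ch bh Lam0 neg.
    move: qd; rewrite ltNge => /negP; apply; rewrite -objq.
    by apply: ereal_inf_lbound; exists (h', Lam).
  have [h Lam ch bh Lam0|mu mufeas qmu] :=
    @primal_existence R S U A A0 Q delta r z nu a b ab (benchmark Y)
      borelS hK delta01 r0 rc mr mz bz uz assumption4 ybb q.
    apply: contrapT => /forallNP npos; apply: pos; exists h, Lam; split => // k.
    by rewrite leNgt; apply/negP; exact: npos.
  move: pq; rewrite ltNge => /negP; apply.
  by apply: (@le_trans _ _ (pairing mu r)%:E); [rewrite lee_fin|apply: ereal_sup_ubound; exists mu].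
- have [h [Lam [feas objcvg hb Lamb]]] := assumption7.
  by apply: (@dual_attained R S U A A0 Q delta r z nu a b ab (benchmark Y)) feas objcvg hb Lamb.
Qed.
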